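(* Let $s\ge 2$ be an integer, let $k_1,\ldots,k_n$ be odd positive integers, and let $d\in\{1,\ldots,n\}$. Let $\mathbb{S}(k_1,\ldots,k_n)^{(d)}$ be the subcomplex of $S^{k_1}\times\cdots\times S^{k_n}$ consisting of all points having at most $d$ coordinates different from the respective base points. Then $$\mathrm{TC}_s\big(\mathbb{S}(k_1,\ldots,k_n)^{(d)}\big)=\min\{sd,\,(s-1)n\}.$$
   Context: Each sphere $S^{k_i}$ has the minimal CW structure $S^{k_i}=e^0\cup e^{k_i}$, with $e^0$ the base point, and the product has the product cell structure with cells $e_J=\{(x_1,\ldots,x_n): x_i=e^0 \text{ if and only if } i\notin J\}$, $J\subseteq[n]=\{1,\ldots,n\}$. Thus $\mathbb{S}(k_1,\ldots,k_n)^{(d)}=\bigcup_{|J|\le d}e_J$, i.e. the subcomplex whose set of cell indices is $\{J\subseteq[n]:|J|\le d\}$, the $(d-1)$-skeleton of the full simplex on $n$ vertices. Higher topological complexity: let $J_s$ be the wedge of $s$ copies of $[0,1]$ with $0$ as base point in each, so that an element of $Y^{J_s}$ is an $s$-tuple $(f_1,\ldots,f_s)$ of paths $[0,1]\to Y$ with a common starting point. For a path connected space $Y$, $\mathrm{TC}_s(Y)$ is the smallest $m\ge 0$ such that $Y^s$ has an open cover by $m+1$ sets on each of which $e_s:Y^{J_s}\to Y^s$, $e_s(f)=(f_1(1),\ldots,f_s(1))$, admits a continuous section. *)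

(* Defs.v *)
From HB Require Import structures.
From mathcomp Require Import all_boot all_order all_algebra.
From mathcomp Require Import all_classical all_reals topology normedtype.
From mathcomp Require Import wedge_sigT.

Set Implicit Arguments.
Unset Strict Implicit.
Unset Printing Implicit Defensive.

Import Order.TTheory GRing.Theory Num.Theory.
Import numFieldNormedType.Exports.
Local Open Scope classical_set_scope.
Local Open Scope ring_scope.

(* A set used as a type carries the topology induced by its ambient space. *)
Definition unit_interval (R : realType) : topologicalType :=
  ([set` `[(0 : R), 1]] : set R).

Lemma unit_interval0_subproof (R : realType) :
  (0 : R) \in ([set` `[(0 : R), 1]] : set R).
Proof. by rewrite inE /= in_itv /= lexx ler01. Qed.

Lemma unit_interval1_subproof (R : realType) :
  (1 : R) \in ([set` `[(0 : R), 1]] : set R).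
Proof. by rewrite inE /= in_itv /= lexx ler01. Qed.

Definition I0 (R : realType) : unit_interval R :=
  exist _ 0 (unit_interval0_subproof R).

Definition I1 (R : realType) : unit_interval R :=
  exist _ 1 (unit_interval1_subproof R).

(* The space J_s: s copies of [0, 1] glued along their points 0. *)
Definition interval_wedge (R : realType) (s : nat) : topologicalType :=
  wedge (fun _ : 'I_s => I0 R).

Definition map_space (X Y : topologicalType) : topologicalType :=
  initial_topology
    (fun f : continuousType X Y => (f : {compact-open, X -> Y})).

Definition power_space (Y : topologicalType) (s : nat) : topologicalType :=
  prod_topology (fun _ : 'I_s => Y).

(* The evaluation map e_s. *)
Definition endpoints (R : realType) (s : nat) (Y : topologicalType)
    (f : map_space (interval_wedge R s) Y) : power_space Y s :=
  fun i => (f : continuousType (interval_wedge R s) Y)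
             (@wedge_lift _ (fun=> unit_interval R) (fun=> I0 R) i (I1 R)).

Definition has_section_over (R : realType) (s : nat) (Y : topologicalType)
    (U : set (power_space Y s)) : Prop :=
  exists sigma : power_space Y s -> map_space (interval_wedge R s) Y,
    {within U, continuous sigma} /\
    (forall y, U y -> endpoints (sigma y) = y).

Definition TC_cover (R : realType) (s : nat) (Y : topologicalType)
    (m : nat) : Prop :=
  exists U : 'I_m.+1 -> set (power_space Y s),
    [/\ forall j, open (U j),
        \bigcup_j U j = setT &
        forall j, has_section_over R (U j)].

(* [is_TC R s Y m] reads TC_s(Y) = m, with m the reduced invariant: a cover by
   m + 1 open sets is required. *)
Definition is_TC (R : realType) (s : nat) (Y : topologicalType)
    (m : nat) : Prop :=
  TC_cover R s Y m /\ forall m', TC_cover R s Y m' -> (m <= m')%N.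

(* The sum of squares is spelled out because the library norm on row vectors
   is the maximum norm. *)
Definition sphere (R : realType) (k : nat) : topologicalType :=
  ([set x : 'rV[R]_k.+1 | \sum_(i < k.+1) x 0 i ^+ 2 = 1] : set 'rV[R]_k.+1).

Section SphereProduct.
Context (R : realType) (n : nat) (k : 'I_n -> nat).

Definition sphere_prod : topologicalType :=
  prod_topology (fun i : 'I_n => sphere R (k i)).

Context (b : forall i, sphere R (k i)).

Definition cell (J : {set 'I_n}) : set sphere_prod :=
  [set x | forall i, x i = b i <-> i \notin J].

Definition skeleton_set (d : nat) : set sphere_prod :=
  [set x | (#|[pred i : 'I_n | x i != b i]| <= d)%N].

Lemma skeleton_setE (d : nat) :
  skeleton_set d = \bigcup_(J in [set J : {set 'I_n} | (#|J| <= d)%N]) cell J.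
Proof.
apply/seteqP; split=> x /=.
- move=> xd; exists (finset (fun i => x i != b i)); first by rewrite /= cardsE.
  by move=> i; rewrite inE negbK; split=> [->|/eqP].
case=> J /= Jd xJ; rewrite /skeleton_set /=; apply: leq_trans Jd.
apply/subset_leq_card/fintype.subsetP => i; rewrite !inE => xb.
by apply/negPn/negP => /xJ /eqP; rewrite (negbTE xb).
Qed.

Definition skeleton (d : nat) : topologicalType := skeleton_set d.

End SphereProduct.

(* Main.v *)
Require Import Defs.
From HB Require Import structures.
From mathcomp Require Import all_boot all_order all_algebra all_fingroup finmap.
From mathcomp Require Import all_classical all_reals topology normedtype.
From mathcomp Require Import interval_inference realfun wedge_sigT.
From mathcomp Require Import zify ring lra.

(* Lower bound.  Put M = min(sd, (s-1)n) spheres at distinct positions of an s x n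
   array with at most d in each row and at most s-1 in each column; their product P
   embeds in the s-th power of the skeleton, all other coordinates being base
   points.  Every column has a free position, so a section of e_s over U gives a
   path from each coordinate of P to the base point: all M projections P -> S^k are
   null-homotopic over U.  Given at most M such open sets covering P, use the p-th
   one, cut off by a Urysohn function, to deform only the p-th coordinate: the
   identity of P becomes homotopic to a map into the set of points having some
   coordinate equal to its base point.  A Sperner-type parity argument on a
   triangulated torus mapping to P with degree one excludes this.

   Upper bound.  Both open covers are indexed by the number of pairs (l, i) whose
   coordinate path has to be the long one (half a great circle along a tangent
   field, then a geodesic) instead of the geodesic.  For sd the paths start at the
   base point, and the pairs requiring the long path have nonbase coordinates, so
   there are at most sd of them; for (s-1)n they start at the first point, and the
   timing of the coordinates keeps the paths inside the skeleton. *)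

Set Implicit Arguments.
Unset Strict Implicit.
Unset Printing Implicit Defensive.

(** * Parity of full simplices in a triangulated torus *)

Definition full (N : nat) (L : seq nat) : bool := perm_eq L (iota 0 N.+1).

(* [map lab (rem x s)] is full iff [map lab s] is [iota 0 N.+1] with the label of
   [x] doubled; so the full faces come in pairs. *)
Lemma full_faces_even (N : nat) (T : eqType) (lab : T -> nat) (s : seq T) :
  (exists2 c, (c <= N.+1)%N & c \notin map lab s) ->
  all (fun x => lab x <= N.+1)%N s ->
  \big[addb/false]_(x <- s) full N (map lab (rem x s)) = false.
Proof.
move=> [c cN cs] /allP labN.
have faceE x : x \in s ->
    full N (map lab (rem x s)) = perm_eq (map lab s) (lab x :: iota 0 N.+1).
  move=> xs; have /permPl -> := perm_map lab (perm_to_rem xs).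
  by rewrite /= perm_cons.
have -> : \big[addb/false]_(x <- s) full N (map lab (rem x s)) =
          \big[addb/false]_(x <- s) perm_eq (map lab s) (lab x :: iota 0 N.+1).
  by rewrite !big_seq; apply: eq_bigr => x xs; rewrite faceE.
have [/hasP[x xs xP]|/hasPn nP] :=
    boolP (has (fun x => perm_eq (map lab s) (lab x :: iota 0 N.+1)) s); last first.
  by rewrite big_seq big1 // => x /nP /negbTE.
(* If the doubled label were [N.+1], every label up to [N.+1] would occur, contrary to the choice of
   [c]. *)
have lxN : (lab x <= N)%N.
  rewrite leqNgt; apply/negP => Nx.
  have lx : lab x = N.+1 by apply/eqP; rewrite eqn_leq labN.
  move: cs; rewrite (perm_mem xP) inE mem_iota add0n ltnS lx leq0n /=.
  by rewrite negb_or -ltnNge => /andP[/eqP cN1 Nc]; apply: cN1; lia.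
have -> : \big[addb/false]_(y <- s) perm_eq (map lab s) (lab y :: iota 0 N.+1)
   = odd (count (fun y => lab y == lab x) s).
  have yE y : perm_eq (map lab s) (lab y :: iota 0 N.+1) = (lab y == lab x).
    rewrite (permPl xP) -[lab x :: _]cat1s -[lab y :: _]cat1s.
    rewrite perm_cat2r; apply/idP/eqP => [/perm_mem/(_ (lab x))|->//].
    by rewrite !inE eqxx => /esym/eqP.
  under eq_bigr do rewrite yE.
  by elim: s {labN faceE xs xP cs yE} => [|y s IH] /=;
    rewrite ?big_nil // big_cons IH oddD; case: eqP.
have -> : count (fun y => lab y == lab x) s = count_mem (lab x) (map lab s).
  by rewrite count_map.
have /seq.permP -> := xP.
rewrite -cat1s count_cat (@count_uniq_mem _ (iota _ _)) ?iota_uniq //.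
by rewrite mem_iota add0n ltnS lxN [count_mem _ _]/= eqxx.
Qed.

Lemma rem_cat_cons (T : eqType) (x : T) (s1 s2 : seq T) :
  x \notin s1 -> rem x (s1 ++ x :: s2) = s1 ++ s2.
Proof.
elim: s1 => [|y s1 IH] /=; first by rewrite eqxx.
by rewrite inE negb_or eq_sym => /andP[/negbTE -> /IH ->].
Qed.

Lemma iota_rcons a n : iota a n.+1 = rcons (iota a n) (a + n).
Proof. by rewrite -cats1 -[n.+1]addn1 iotaD. Qed.

Section KuhnTorus.
Variables (N' m : nat).
Local Notation N := N'.+1.
Local Notation grid := {ffun 'I_N -> 'I_m}.

Local Notation simplex := (grid * {perm 'I_N})%type.

(* The i-th vertex of the Kuhn simplex at [S.1], where coordinate q is raised at
   step [S.2 q]. *)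
Definition vtx (S : simplex) (i : nat) : grid :=
  [ffun q => if (S.2 q < i)%N then ordS (S.1 q) else S.1 q].

Lemma xor_involution (f : simplex -> bool) (t : simplex -> simplex)
    (c : pred simplex) :
  involutive t -> (forall S, f (t S) = f S) -> (forall S, c (t S) = ~~ c S) ->
  \big[addb/false]_S f S = false.
Proof.
move=> tK ft ct; rewrite (bigID c) /=.
rewrite (reindex_inj (inv_inj tK)) /=.
under eq_bigl do rewrite ct.
by under eq_bigr do rewrite ft; rewrite addbb.
Qed.

(** The neighbour of [S] across the facet opposite its [j]-th vertex, for [0 < j < N]: the
    coordinates raised at steps [j.-1] and [j] trade places. *)
Definition swap_at (j : nat) (S : simplex) : simplex :=
  (S.1, (S.2 * tperm (inord j.-1) (inord j))%g).

Lemma vtx_swap (j i : nat) S : (0 < j < N)%N -> i != j ->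
  vtx (swap_at j S) i = vtx S i.
Proof.
move=> /andP[j0 jN] ij; apply/ffunP => q; rewrite !ffunE /= permM.
suff -> : (tperm (inord j.-1) (inord j) (S.2 q) < i)%N = (S.2 q < i)%N by [].
case: tpermP => [->|->|//]; rewrite !inordK; lia.
Qed.

(** A list that avoids level [j] reads the same labels on [S] and on [swap_at j S], so the simplices
    cancel in pairs. The order in which the two exchanged steps occur tells the members of a pair
    apart. *)
Lemma sum_face_interior (g : grid -> nat -> nat) (l : seq (nat * nat)) (j : nat) :
  (0 < j < N)%N -> (forall x, x \in l -> x.2 != j) ->
  \big[addb/false]_S full N (map (fun x => g (vtx S x.2) x.1) l) = false.
Proof.
move=> jN lj.
have pq : inord j.-1 != inord j :> 'I_N.
  by rewrite -val_eqE /= !inordK; lia.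
apply: (@xor_involution _ (swap_at j)
  (fun S => (S.2^-1%g (inord j.-1) < S.2^-1%g (inord j))%N)) => [S|S|S].
- by case: S => v p; rewrite /swap_at /= -mulgA tperm2 mulg1.
- congr (full _ _); apply/eq_in_map => x xl.
  by rewrite vtx_swap // lj.
- rewrite /= invMg tpermV !permM tpermL tpermR.
  by rewrite -leqNgt ltn_neqAle val_eqE (inj_eq perm_inj) eq_sym pq.
Qed.

Definition shift_ffun (p : {perm 'I_N}) : {ffun 'I_N -> 'I_N} :=
  [ffun q => ord_pred (p q)].
Lemma shift_inj p : injective (shift_ffun p).
Proof. by move=> x y; rewrite !ffunE => /(can_inj (@ord_predK _))/perm_inj. Qed.
Definition unshift_ffun (p : {perm 'I_N}) : {ffun 'I_N -> 'I_N} :=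
  [ffun q => ordS (p q)].
Lemma unshift_inj p : injective (unshift_ffun p).
Proof. by move=> x y; rewrite !ffunE => /(can_inj (@ordSK _))/perm_inj. Qed.

(** The neighbour across the facet opposite vertex 0: the coordinate raised first is raised at the
    start and becomes the last one to move. On the torus this neighbour always exists. *)
Definition shift (S : simplex) : simplex :=
  ([ffun q => if S.2 q == ord0 then ordS (S.1 q) else S.1 q], perm (@shift_inj S.2)).
Definition unshift (S : simplex) : simplex :=
  ([ffun q => if S.2 q == ord_max then ord_pred (S.1 q) else S.1 q],
   perm (@unshift_inj S.2)).

Lemma ord_pred_max (i : 'I_N) : (ord_pred i == ord_max) = (i == ord0).
Proof.
rewrite -!val_eqE /=; case: i => [[|i] iN] /=.
  by rewrite modn_small ?eqxx.
by rewrite modnDr modn_small; lia.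
Qed.

Lemma shiftK : cancel shift unshift.
Proof.
case=> v p; rewrite /shift /unshift /=; congr pair.
  apply/ffunP => q; rewrite !ffunE permE !ffunE ord_pred_max.
  by case: eqP => // _; rewrite ordSK.
by apply/permP => q; rewrite permE ffunE permE ffunE ord_predK.
Qed.

Lemma vtx_shift S i : (i < N)%N -> vtx (shift S) i = vtx S i.+1.
Proof.
move=> iN; apply/ffunP => q; rewrite !ffunE /= permE ffunE.
have [p0|p0] := eqVneq (S.2 q) ord0.
  have /eqP -> : ord_pred (S.2 q) == ord_max by rewrite ord_pred_max p0.
  by rewrite p0 /= ifF //; apply/negbTE; rewrite -leqNgt.
have -> : (ord_pred (S.2 q) < i)%N = (S.2 q < i.+1)%N; last by [].
have pq0 : (0 < S.2 q)%N by rewrite lt0n; apply: contra p0.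
have pqN := ltn_ord (S.2 q).
rewrite /= -subn1 addnC -addnBA // subn1 modnDl modn_small; lia.
Qed.

(** * Invariance of the parity: a prism over the torus *)

Section Step.
Variables (la lb : grid -> nat).
Let g (v : grid) (c : nat) := if c == 0 then la v else lb v.
Let lab (S : simplex) (x : nat * nat) := g (vtx S x.2) x.1.
Let cnt (l : seq (nat * nat)) :=
  \big[addb/false]_S full N (map (lab S) l).
(** The standard triangulation of the prism over [S]. A pair [(c, j)] is vertex [j] of the bottom
    ([c = 0], labelled by [la]) or of the top ([c = 1], labelled by [lb]). The [T i] are the
    top-dimensional simplices and [D i] is the wall between [T i.-1] and [T i]; thus [D 0] is the
    top and [D N.+1] the bottom. *)
Let T i := map (pair 0) (iota 0 i.+1) ++ map (pair 1) (iota i (N.+1 - i)).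
Let D i := map (pair 0) (iota 0 i) ++ map (pair 1) (iota i (N.+1 - i)).

Let memT i x : (x \in T i) =
  ((x.1 == 0) && (x.2 <= i) || (x.1 == 1) && (i <= x.2 <= N))%N.
Proof.
case: x => c j; rewrite /T mem_cat; congr orb.
  apply/mapP/andP => [[k]|[/eqP/= -> ji]].
    by rewrite mem_iota add0n ltnS => ki [-> ->].
  by exists j => //; rewrite -[_ :: _]/(iota 0 i.+1) mem_iota add0n ltnS.
apply/mapP/andP => [[k]|[/eqP/= -> ji]].
  by rewrite mem_iota => ki [-> ->]; split=> //=; lia.
by exists j; rewrite // mem_iota; lia.
Qed.

Let uniqT i : uniq (T i).
Proof.
have pI c : injective (pair c : nat -> nat * nat) by move=> x y [].
rewrite cat_uniq !(map_inj_uniq (pI _)) !iota_uniq andbT /=.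
by apply/hasPn => x /mapP[j _ ->]; apply/mapP => -[k _].
Qed.

Let cnt_rem i c j : (c, j) \in T i -> (0 < j < N)%N -> j != i ->
  cnt (rem (c, j) (T i)) = false.
Proof.
move=> cT jN ji; apply: sum_face_interior jN _ => -[c' j'].
rewrite mem_rem_uniq // inE /= xpair_eqE memT => /andP[ne xT] /=.
apply/eqP => j'j; subst j'; move: cT xT ne ji; rewrite memT /=.
by rewrite eqxx andbT; lia.
Qed.

Let notin_iota (c c' j a n : nat) : ~~ (c == c') || ~~ (a <= j < a + n)%N ->
  (c, j) \notin map (pair c') (iota a n).
Proof.
move=> cj; apply/mapP => -[k]; rewrite mem_iota => ka [ec ek].
by move: cj; rewrite ec ek eqxx ka.
Qed.

Let rem_diag0 i : (i <= N)%N -> rem (0, i) (T i) = D i.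
Proof.
move=> iN; rewrite /T /D -addn1 iotaD map_cat add0n -catA rem_cat_cons //.
by apply: notin_iota; rewrite ltnn andbF orbT.
Qed.

Let rem_diag1 i : (i <= N)%N -> rem (1, i) (T i) = D i.+1.
Proof.
move=> iN; rewrite /T /D subSn // [iota i _]/= [map (pair 1) (_ :: _)]/=.
by rewrite rem_cat_cons ?subSS //; apply: notin_iota.
Qed.

(** A side face of the prism over [S] is also a side face of the prism over [shift S]; reindexing by
    [shift] identifies the two counts. *)
Let cnt_shift i : (0 < i <= N)%N ->
  cnt (rem (0, 0) (T i)) = cnt (rem (1, N) (T i.-1)).
Proof.
case: i => // i; rewrite -pred_Sn => /andP[_ iN].
have -> : rem (0, 0) (T i.+1) =
    map (pair 0) (iota 1 i.+1) ++ map (pair 1) (iota i.+1 (N - i)).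
  by rewrite /T subSS.
rewrite /T.
have -> : iota i (N.+1 - i) = rcons (iota i (N - i)) N.
  by rewrite subSn 1?ltnW // -addn1 iotaD cats1; congr rcons; lia.
rewrite map_rcons -cats1 catA rem_cat_cons ?cats0; last first.
  by rewrite mem_cat negb_or; apply/andP; split; apply: notin_iota; lia.
rewrite /cnt [RHS](reindex_inj (can_inj shiftK)).
apply: eq_bigr => S _; congr (full _ _).
have iotaS a n : iota a.+1 n = map succn (iota a n) by rewrite -add1n iotaDl.
rewrite (iotaS 0 i.+1) (iotaS i) !map_cat -!map_comp.
congr (_ ++ _); apply/eq_in_map => k; rewrite mem_iota => kN /=;
  by rewrite /lab /= vtx_shift //; lia.
Qed.

(** Each prism simplex misses a label, hence has an even number of full facets. Summed over the
    whole prism, facets missing an inner level cancel by [sum_face_interior], side faces by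
    [cnt_shift], and inner walls are counted twice; only the bottom and the top remain. *)
Lemma full_count_step :
  (forall v, la v <= N.+1)%N -> (forall v, lb v <= N.+1)%N ->
  (forall S, exists2 c, (c <= N.+1)%N & forall i, (i <= N)%N ->
     (la (vtx S i) != c) && (lb (vtx S i) != c)) ->
  \big[addb/false]_S full N (map (fun i => la (vtx S i)) (iota 0 N.+1)) =
  \big[addb/false]_S full N (map (fun i => lb (vtx S i)) (iota 0 N.+1)).
Proof.
move=> laN lbN miss.
have total i : (i <= N)%N ->
    \big[addb/false]_(x <- T i) cnt (rem x (T i)) = false.
  move=> iN; rewrite /cnt exchange_big /= big1 // => S _.
  apply: full_faces_even; last by apply/allP => x _; rewrite /lab /g; case: ifP.
  have [c cN Sc] := miss S; exists c => //.
  apply/mapP => -[[c' j]]; rewrite memT /= /lab /g /= => xT cE.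
  have /Sc : (j <= N)%N by lia.
  by move: cE; case: ifP => _ ->; rewrite eqxx ?andbF.
(* [E] counts the walls, [A] and [B] the side faces. The guards are there because the face opposite
   [(0, 0)] in [T 0] and the one opposite [(1, N)] in [T N] are the walls [D 0] and [D N.+1]. *)
pose E i := cnt (D i); pose A i := (0 < i)%N && cnt (rem (0, 0) (T i)).
pose B i := (i < N)%N && cnt (rem (1, N) (T i)).
have split_total i : (i <= N)%N -> (A i (+) E i) (+) (E i.+1 (+) B i) = false.
  move=> iN; rewrite -[RHS](total i iN) {1}/T big_cat !big_map; congr addb.
    have [->|i0] := posnP i.
      by rewrite big_cons big_nil rem_diag0 // /A /= addbF.
    have -> : iota 0 i.+1 = 0 :: rcons (iota 1 i.-1) i.
      by case: {+}i i0 => // k _; rewrite -[LHS]/(0 :: iota 1 k.+1) iota_rcons add1n.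
    rewrite big_cons big_rcons rem_diag0 // big_seq big1 /A ?i0 ?addbF //.
    move=> j; rewrite mem_iota => j1; rewrite cnt_rem ?memT /=; lia.
  have -> : iota i (N.+1 - i) = i :: iota i.+1 (N - i) by rewrite subSn.
  rewrite big_cons rem_diag1 //; congr addb.
  have [iN'|Ni] := ltnP i N; last first.
    by rewrite (_ : N - i = 0)%N ?big_nil /B ?ltnNge ?Ni //; lia.
  have -> : iota i.+1 (N - i) = rcons (iota i.+1 (N - i).-1) N.
    by rewrite -[in LHS](@prednK (N - i)) ?subn_gt0 // iota_rcons; congr rcons; lia.
  rewrite big_rcons big_seq big1 /B ?iN' ?addbF //.
  by move=> j; rewrite mem_iota => j1; rewrite cnt_rem ?memT /=; lia.
have tele i : (i <= N)%N -> E 0 (+) E i.+1 (+) B i = false.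
  elim: i => [|i IH] iN.
    by have := split_total 0 iN; rewrite /A /= addbA.
  have := IH (ltnW iN); have := split_total i.+1 iN.
  have -> : A i.+1 = B i by rewrite /A /B iN cnt_shift.
  by case: (B i); case: (E 0); case: (E i.+1); case: (E i.+2); case: (B i.+1).
have EE : E 0 = E N.+1.
  by have := tele N (leqnn N); rewrite /B ltnn addbF; case: (E 0); case: (E N.+1).
have -> : \big[addb/false]_S full N (map (fun i => la (vtx S i)) (iota 0 N.+1)) = E N.+1.
  by apply: eq_bigr => S _; rewrite /D subnn cats0 -map_comp.
rewrite -EE; apply: eq_bigr => S _.
by rewrite /D subn0 -map_comp.
Qed.
End Step.
End KuhnTorus.

(** * Labellings with an odd number of full simplices *)

Section Labelings.
Variables (N' h : nat).
Local Notation N := N'.+1.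
Local Notation m := (h.+1.*2).
Local Notation grid := {ffun 'I_N -> 'I_m}.

Definition full_count (la : grid -> nat) : bool :=
  \big[addb/false]_(S : grid * {perm 'I_N})
    full N (map (fun i => la (vtx S i)) (iota 0 N.+1)).

Lemma full_count_homotopy (la : nat -> grid -> nat) (T : nat) :
  (forall j v, la j v <= N.+1)%N ->
  (forall j (S : grid * {perm 'I_N}), (j < T)%N ->
     exists2 c, (c <= N.+1)%N & forall i, (i <= N)%N ->
     (la j (vtx S i) != c) && (la j.+1 (vtx S i) != c)) ->
  full_count (la 0) = full_count (la T).
Proof.
move=> laN; elim: T => // T IH miss.
rewrite IH => [|j S jT]; last by apply: miss; apply: ltnW.
by apply: full_count_step => // S; apply: miss.
Qed.

(** The grid form of the index of the first negative coordinate, since the middle of the grid lies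
    at [h.+1]; the value is [N] if there is none. *)
Definition first_below (v : grid) : nat :=
  find (fun q : 'I_N => v q < h.+1)%N (enum 'I_N).

Lemma first_below_le v : (first_below v <= N)%N.
Proof. by rewrite -[X in (_ <= X)%N](size_enum_ord N) find_size. Qed.

Lemma first_below_lt v (i : 'I_N) : (i < first_below v)%N -> (h < v i)%N.
Proof.
by move=> /(before_find i)/negbT; rewrite nth_ord_enum -leqNgt.
Qed.

Lemma first_below_eq v (i : 'I_N) : first_below v = i -> (v i <= h)%N.
Proof.
move=> vi; have := @nth_find _ i (fun q : 'I_N => v q < h.+1)%N (enum 'I_N).
rewrite -/(first_below v) vi nth_ord_enum; apply.
by rewrite has_find -/(first_below v) vi size_enum_ord.
Qed.

(** Exactly one simplex is full: the one at the point with all coordinates [h], raised in the order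
    of their indices. *)
Lemma full_count_first_below (core : pred grid) :
  (forall v q, core v -> (v q).+1 != m) ->
  (forall v : grid, (forall q, v q = h :> nat \/ v q = h.+1 :> nat) -> core v) ->
  full_count (fun v => if core v then first_below v else N.+1) = true.
Proof.
move=> core_seam core_mid; set la := fun v : grid => _.
have hm : (h < m)%N by lia.
pose S0 : grid * {perm 'I_N} := ([ffun=> Ordinal hm], 1%g).
have S0q i q : vtx S0 i q = (if (q < i)%N then h.+1 else h) :> nat.
  rewrite !ffunE /= perm1; case: ifP => // _.
  by rewrite /= modn_small //; lia.
have S0core i : core (vtx S0 i).
  by apply: core_mid => q; rewrite S0q; case: ifP; [right|left].
have S0la i : (i <= N)%N -> la (vtx S0 i) = i.
  move=> iN; rewrite /la S0core; apply/eqP; rewrite eqn_leq; apply/andP; split.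
    rewrite leqNgt; apply/negP => il.
    have iN' : (i < N)%N by apply: leq_trans il (first_below_le _).
    have := @first_below_lt (vtx S0 i) (Ordinal iN') il.
    by rewrite S0q /= ltnn ltnn.
  rewrite leqNgt; apply/negP => li.
  have lN : (first_below (vtx S0 i) < N)%N by lia.
  have := @first_below_eq (vtx S0 i) (Ordinal lN) erefl.
  by rewrite S0q /= li ltnn.
have fullS0 : full N [seq la (vtx S0 i) | i <- iota 0 N.+1].
  rewrite /full (_ : map _ _ = iota 0 N.+1) ?perm_refl //.
  rewrite -[RHS]map_id; apply/eq_in_map => i; rewrite mem_iota => iN.
  by apply: S0la; lia.
rewrite /full_count (bigD1 S0) //= big1; first by rewrite fullS0.
move=> S /eqP SS0; apply/negbTE/negP => fS; apply: SS0.
have coreS i : (i <= N)%N -> core (vtx S i).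
  move=> iN; case: (boolP (core _)) => // nc; exfalso.
  have iI : i \in iota 0 N.+1 by rewrite mem_iota.
  have := perm_mem fS (la (vtx S i)).
  rewrite (map_f (fun i => la (vtx S i)) iI) mem_iota /la (negbTE nc).
  by rewrite add0n ltnn andbF.
have labE i : (i <= N)%N -> la (vtx S i) = first_below (vtx S i).
  by move=> /coreS; rewrite /la => ->.
(* A full simplex lies in the core, where no coordinate wraps around. So coordinates only grow along
   its vertices, and so does the label; a nondecreasing enumeration of [0, ..., N] is the
   identity. *)
have step i : (i < N)%N -> (la (vtx S i) <= la (vtx S i.+1))%N.
  move=> iN; rewrite !labE //; last exact: ltnW.
  apply: sub_find => q; have := core_seam _ q (coreS i (ltnW iN)).
  rewrite !ffunE; have [Sq|Sq] := ltnP (S.2 q) i.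
    by rewrite (leq_trans Sq).
  case: ifP => // _; rewrite /= => nm; rewrite modn_small; first exact: ltnW.
  by rewrite ltn_neqAle nm ltn_ord.
have labi : [seq la (vtx S i) | i <- iota 0 N.+1] = iota 0 N.+1.
  apply: (sorted_eq leq_trans anti_leq) => //; last exact: iota_sorted.
  apply/(sortedP 0) => i; rewrite size_map size_iota => iN.
  rewrite !(nth_map 0) ?size_iota ?nth_iota //; try lia.
  by rewrite !add0n; apply: step; lia.
have lai i : (i <= N)%N -> la (vtx S i) = i.
  move=> iN; have := congr1 (fun l => nth 0 l i) labi.
  by rewrite (nth_map 0) ?size_iota // nth_iota.
(* The labels [q] and [q.+1] at consecutive vertices force coordinate [q] to pass from [h] to [h.+1]
   exactly at step [q], which determines [S]. *)
have flip (q : 'I_N) : (vtx S q q <= h)%N /\ (h < vtx S q.+1 q)%N.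
  split; first by apply: first_below_eq; rewrite -labE ?lai // ltnW.
  by apply: first_below_lt; rewrite -labE ?lai.
have S2q (q : 'I_N) : S.2 q = q :> nat /\ S.1 q = h :> nat.
  have [] := flip q; rewrite !ffunE.
  have := core_seam _ q (coreS q (ltnW (ltn_ord q))); rewrite ffunE.
  have := ltn_ord (S.1 q).
  move=> l0; case: (ltnP (S.2 q) q) => c1; case: (ltnP (S.2 q) q.+1) => c2 /=;
    move=> l1 l2 l3; [lia|lia| |lia].
  move: l3; rewrite modn_small; last by rewrite ltn_neqAle l1 l0.
  move=> l3; split; apply/eqP; rewrite eqn_leq; first by rewrite -ltnS c2 c1.
  by rewrite l2 -ltnS l3.
case: S S2q {fS coreS labE step labi lai flip} => v p /= S2q; congr pair.
  by apply/ffunP => q; apply/val_inj; rewrite ffunE /=; case: (S2q q).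
by apply/permP => q; apply/val_inj; rewrite perm1; case: (S2q q).
Qed.

End Labelings.

Import Order.TTheory GRing.Theory Num.Theory.
Import numFieldNormedType.Exports.
Local Open Scope classical_set_scope.
Local Open Scope ring_scope.

(** * Pointwise continuity; spheres *)

Lemma cvg_subtype (T : topologicalType) (A : set T) (I : Type)
    (F : set_system I) {FF : Filter F} (f : I -> A) (x : A) :
  (fun i => \val (f i)) @ F --> \val x -> f @ F --> x.
Proof.
move=> fx U [V [[W oW WV] Vx VU]]; rewrite nbhs_simpl /=.
have Wx : nbhs (\val x) W.
  by apply: open_nbhs_nbhs; split => //; move: Vx; rewrite -WV.
apply: (@filterS _ F FF (fun i => W (\val (f i)))); last exact: fx Wx.
by move=> i Wi; apply: VU; rewrite -WV.
Qed.

(* A constant, and not the convergence statement itself, so that the closure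
   lemmas below apply by unification of the function. *)
Definition cont_at (T U : topologicalType) (f : T -> U) (x : T) : Prop :=
  f @ x --> f x.

Lemma cont_atP (T U : topologicalType) (f : T -> U) :
  (forall x, cont_at f x) -> continuous f.
Proof. by []. Qed.

Section ContAt.
Variables (T : topologicalType).

Lemma cont_at_cst (U : topologicalType) (c : U) (x : T) : cont_at (fun=> c) x.
Proof. exact: cvg_cst. Qed.

Lemma cont_at_comp (U V : topologicalType) (f : T -> U) (g : U -> V) (x : T) :
  cont_at f x -> cont_at g (f x) -> cont_at (fun y => g (f y)) x.
Proof. exact: continuous_comp. Qed.

Lemma cont_at_pair (U V : topologicalType) (f : T -> U) (g : T -> V) (x : T) :
  cont_at f x -> cont_at g x -> cont_at (fun y => (f y, g y)) x.
Proof. exact: cvg_pair. Qed.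

Lemma cont_at_id (x : T) : cont_at (fun y : T => y) x.
Proof. exact: cvg_id. Qed.

Lemma cont_at_near (U : topologicalType) (f g : T -> U) (x : T) :
  (\forall y \near x, f y = g y) -> cont_at g x -> cont_at f x.
Proof.
move=> fg cg; rewrite /cont_at (nbhs_singleton fg); apply: cvg_trans cg.
by apply: near_eq_cvg; apply: filterS fg => y ->.
Qed.

Lemma cont_at_subtype (U : topologicalType) (A : set U) (f : T -> A) (x : T) :
  cont_at (fun y => \val (f y)) x -> cont_at f x.
Proof. exact: cvg_subtype. Qed.

Lemma cont_at_val (U : topologicalType) (A : set U) (f : T -> A) (x : T) :
  cont_at f x -> cont_at (fun y => \val (f y)) x.
Proof.
move=> cf; apply: (@cont_at_comp _ _ f (fun z : A => \val z) x cf).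
exact: initial_continuous.
Qed.

Variable R : realType.
Implicit Types (f g : T -> R) (x : T).

Lemma cont_at_add f g x : cont_at f x -> cont_at g x -> cont_at (fun y => f y + g y) x.
Proof. exact: cvgD. Qed.

Lemma cont_at_opp f x : cont_at f x -> cont_at (fun y => - f y) x.
Proof. exact: cvgN. Qed.

Lemma cont_at_mul f g x : cont_at f x -> cont_at g x -> cont_at (fun y => f y * g y) x.
Proof. exact: cvgM. Qed.

Lemma cont_at_inv f x : f x != 0 -> cont_at f x -> cont_at (fun y => (f y)^-1) x.
Proof. exact: cvgV. Qed.

Lemma cont_at_max f g x :
  cont_at f x -> cont_at g x -> cont_at (fun y => Num.max (f y) (g y)) x.
Proof. by apply: continuous2_cvg; exact: max_continuous (f x, g x). Qed.

Lemma cont_at_min f g x :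
  cont_at f x -> cont_at g x -> cont_at (fun y => Num.min (f y) (g y)) x.
Proof. by apply: continuous2_cvg; exact: min_continuous (f x, g x). Qed.

Lemma cont_at_norm f x : cont_at f x -> cont_at (fun y => `|f y|) x.
Proof. exact: cvg_norm. Qed.

Lemma cont_at_sum (J : finType) (f : J -> T -> R) x :
  (forall j, cont_at (f j) x) -> cont_at (fun y => \sum_j f j y) x.
Proof.
have add_cont : continuous (fun z : R * R => z.1 + z.2).
  by move=> z; apply: cvgD; [exact: cvg_fst|exact: cvg_snd].
move=> fa; apply: (@cvg_big _ _ +%R 0 predT add_cont _ (nbhs x) _ f (fun j => f j x)).
by move=> j _; apply: fa.
Qed.

Lemma cont_at_gt f x c : c < f x -> cont_at f x -> \forall y \near x, c < f y.
Proof. by move=> cf cx; apply: (@cvgr_gt _ _ (nbhs x) _ f (f x) cx). Qed.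

Lemma cont_at_lt f x c : f x < c -> cont_at f x -> \forall y \near x, f y < c.
Proof. by move=> cf cx; apply: (@cvgr_lt _ _ (nbhs x) _ f (f x) cx). Qed.

Lemma cont_at_entry n (f : T -> 'rV[R]_n) j x :
  cont_at f x -> cont_at (fun y => f y 0 j) x.
Proof.
move=> cf; apply: (@cont_at_comp _ _ f (fun v : 'rV[R]_n => v 0 j) x cf).
exact: coord_continuous.
Qed.

Lemma cont_at_scale n (a : T -> R) (f : T -> 'rV[R]_n) x :
  cont_at a x -> cont_at f x -> cont_at (fun y => a y *: f y) x.
Proof. exact: cvgZ. Qed.

Lemma cont_at_addv n (f g : T -> 'rV[R]_n) x :
  cont_at f x -> cont_at g x -> cont_at (fun y => f y + g y) x.
Proof. exact: cvgD. Qed.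

Lemma cont_at_rV n (f : T -> 'rV[R]_n) x :
  (forall j, cont_at (fun y => f y 0 j) x) -> cont_at f x.
Proof.
move=> fv U [P Pv PU]; rewrite nbhs_simpl /=.
have : \forall y \near x, forall j, P 0 j (f y 0 j).
  by apply: filter_forall => j; apply: (fv j); apply: Pv.
by apply: filterS => y Py; apply: PU => a j; rewrite ord1; apply: Py.
Qed.

Lemma cont_at_prod (I : eqType) (K : I -> topologicalType)
    (f : T -> prod_topology K) x :
  (forall i, cont_at (fun y => f y i) x) -> cont_at f x.
Proof.
move=> fx; apply/cvg_sup => i U [V [[W oW WV] Vx VU]]; rewrite nbhs_simpl /=.
have Wx : nbhs (f x i) W.
  by apply: open_nbhs_nbhs; split => //; move: Vx; rewrite -WV.
apply: (@filterS _ (nbhs x) _ (fun y => W (f y i))); last exact: fx Wx.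
by move=> y Wy; apply: VU; rewrite -WV.
Qed.

Lemma cont_at_coord (I : eqType) (K : I -> topologicalType)
    (f : T -> prod_topology K) x i :
  cont_at f x -> cont_at (fun y => f y i) x.
Proof.
move=> cf; apply: (@cont_at_comp _ _ f (fun z : prod_topology K => z i) x cf).
exact: proj_continuous.
Qed.

End ContAt.

(** * Unit vectors and normalization *)

Section Spheres.
Variable R : realType.

Definition dot n (u v : 'rV[R]_n) : R := \sum_i u 0 i * v 0 i.

Lemma dotC n (u v : 'rV[R]_n) : dot u v = dot v u.
Proof. by apply: eq_bigr => i _; rewrite mulrC. Qed.

Lemma dotDl n (u v w : 'rV[R]_n) : dot (u + v) w = dot u w + dot v w.
Proof. by rewrite -big_split; apply: eq_bigr => i _; rewrite !mxE mulrDl. Qed.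

Lemma dotZl n a (u v : 'rV[R]_n) : dot (a *: u) v = a * dot u v.
Proof. by rewrite mulr_sumr; apply: eq_bigr => i _; rewrite !mxE mulrA. Qed.

Lemma dotDr n (u v w : 'rV[R]_n) : dot u (v + w) = dot u v + dot u w.
Proof. by rewrite dotC dotDl !(dotC u). Qed.

Lemma dotZr n a (u v : 'rV[R]_n) : dot u (a *: v) = a * dot u v.
Proof. by rewrite dotC dotZl dotC. Qed.

Lemma dot_ge0 n (u : 'rV[R]_n) : 0 <= dot u u.
Proof. by apply: sumr_ge0 => i _; rewrite -expr2 sqr_ge0. Qed.

Lemma dot_eq0 n (u : 'rV[R]_n) : dot u u = 0 -> u = 0.
Proof.
move=> u0; apply/rowP => i; rewrite mxE; apply/eqP; rewrite -sqrf_eq0 expr2.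
apply/eqP/(psumr_eq0P _ u0) => // j _; by rewrite -expr2 sqr_ge0.
Qed.

Lemma dot_gt0 n (u : 'rV[R]_n) : u != 0 -> 0 < dot u u.
Proof.
by move=> u0; rewrite lt_neqAle dot_ge0 andbT eq_sym; apply: contra u0 => /eqP/dot_eq0 ->.
Qed.

Lemma dot0l n (u : 'rV[R]_n) : dot 0 u = 0.
Proof. by rewrite /dot big1 // => i _; rewrite mxE mul0r. Qed.

Variable k : nat.

Lemma sphere_unit (x : sphere R k) : dot (\val x) (\val x) = 1.
Proof.
by apply: etrans (set_valP x); apply: eq_bigr => i _; rewrite expr2.
Qed.

Lemma sphere_neq0 (x : sphere R k) : \val x != 0.
Proof.
by apply/eqP => x0; have /eqP := sphere_unit x; rewrite x0 dot0l eq_sym oner_eq0.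
Qed.

Lemma in_sphere (v : 'rV[R]_k.+1) : dot v v = 1 ->
  v \in [set x : 'rV[R]_k.+1 | \sum_(i < k.+1) x 0 i ^+ 2 = 1].
Proof. by move=> v1; rewrite inE /= -v1; apply: eq_bigr => i _; rewrite expr2. Qed.

(** The value at 0 is an arbitrary unit vector, which makes [normalize] total. *)
Definition normalize_row (v : 'rV[R]_k.+1) : 'rV[R]_k.+1 :=
  if v == 0 then delta_mx 0 0 else (Num.sqrt (dot v v))^-1 *: v.

Lemma normalize_row_unit v : dot (normalize_row v) (normalize_row v) = 1.
Proof.
rewrite /normalize_row; have [_|v0] := eqVneq v 0.
  rewrite /dot (bigD1 0) //= !mxE !eqxx mulr1 big1 ?addr0 // => i i0.
  by rewrite mxE (negbTE i0) andbF mulr0.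
have dv := dot_gt0 v0.
rewrite dotZl dotZr mulrA -invfM -expr2 sqr_sqrtr ?mulVf ?gt_eqF ?ltW //.
Qed.

Definition normalize (v : 'rV[R]_k.+1) : sphere R k :=
  exist _ (normalize_row v) (in_sphere (normalize_row_unit v)).

Lemma val_normalize v : v != 0 -> \val (normalize v) = (Num.sqrt (dot v v))^-1 *: v.
Proof. by rewrite /= /normalize_row => /negbTE ->. Qed.

Lemma normalize_scale a (x : sphere R k) : 0 < a -> normalize (a *: \val x) = x.
Proof.
move=> a0; apply: val_inj; rewrite val_normalize; last first.
  by rewrite scaler_eq0 gt_eqF //= sphere_neq0.
rewrite dotZl dotZr sphere_unit mulr1 -expr2 sqrtr_sqr ger0_norm ?ltW //.
by rewrite scalerA mulVf ?scale1r // gt_eqF.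
Qed.

Lemma cont_at_dot (T : topologicalType) (f g : T -> 'rV[R]_k.+1) (x : T) :
  cont_at f x -> cont_at g x -> cont_at (fun y => dot (f y) (g y)) x.
Proof.
by move=> fx gx; apply: cont_at_sum => j; apply: cont_at_mul; apply: cont_at_entry.
Qed.

Lemma cont_at_normalize (T : topologicalType) (f : T -> 'rV[R]_k.+1) (x : T) :
  f x != 0 -> cont_at f x -> cont_at (fun y => normalize (f y)) x.
Proof.
move=> fx0 cf; apply: cont_at_subtype.
have df : cont_at (fun y => dot (f y) (f y)) x by apply: cont_at_dot.
apply: (@cont_at_near _ _ _ (fun y => (Num.sqrt (dot (f y) (f y)))^-1 *: f y)).
  have : \forall y \near x, 0 < dot (f y) (f y).
    by apply: (cont_at_gt _ df); exact: dot_gt0.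
  apply: filterS => y dy; rewrite val_normalize //.
  by apply/eqP => fy0; move: dy; rewrite fy0 dot0l ltxx.
apply: cont_at_scale cf; apply: cont_at_inv; first by rewrite gt_eqF // sqrtr_gt0 dot_gt0.
by apply: (cont_at_comp df (g := @Num.sqrt R)); exact: sqrt_continuous.
Qed.

Lemma val_injective_hausdorff (X : topologicalType) (A : set X) :
  hausdorff_space X -> hausdorff_space A.
Proof.
move=> hT x y xy; apply/val_inj/hT => U V nU nV.
have [z [Uz Vz]] := xy _ _ (initial_continuous nU) (initial_continuous nV).
by exists (\val z).
Qed.

Lemma compact_subtype (X : topologicalType) (A : set X) :
  compact A -> compact [set: A].
Proof.
move=> cA F PF _.
have FA : ((fun x : A => \val x) @ F) A.
  by apply: (@filterS _ F _ setT) filterT => x _; apply: set_valP.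
have [x [Ax clx]] := cA _ _ FA; exists (exist _ x (mem_set Ax)); split => //.
move=> V U FV [U' [[W oW WU'] Wx U'U]].
have Fval : ((fun x : A => \val x) @ F) ((fun x : A => \val x) @` V).
  by apply: (@filterS _ F _ V) => // v Vv; exists v.
have Wn : nbhs x W by apply: open_nbhs_nbhs; split => //; move: Wx; rewrite -WU'.
have [_ [[v Vv <-] Wv]] := clx _ _ Fval Wn.
by exists v; split => //; apply: U'U; rewrite -WU'.
Qed.

Lemma sphere_hausdorff : hausdorff_space (sphere R k).
Proof. exact/val_injective_hausdorff/norm_hausdorff. Qed.

Lemma sphere_compact : compact [set: sphere R k].
Proof.
apply: compact_subtype.
have sub := @subclosed_compact 'rV[R]_k.+1 _
  [set v : 'rV[R]_k.+1 | forall i, `[(-1 : R), 1]%classic (v ord0 i)].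
apply: sub.
- have -> : [set x : 'rV[R]_k.+1 | \sum_(i < k.+1) x 0 i ^+ 2 = 1] =
     (fun x => dot x x) @^-1` [set 1].
    by apply/seteqP; split => x /= <-; apply: eq_bigr => i _; rewrite expr2.
  apply: closed_comp => [x _|]; last exact: closed_eq.
  by apply: (@cont_at_dot _ id id); exact: cvg_id.
- apply: (@rV_compact R k.+1 (fun=> `[(-1 : R), 1]%classic)) => i.
  exact: segment_compact.
move=> x /= x1 i; rewrite in_itv /= -ler_norml -(@expr_le1 _ 2) // real_normK ?num_real // -x1.
by rewrite (bigD1 i) //= lerDl; apply: sumr_ge0 => j _; apply: sqr_ge0.
Qed.
End Spheres.

(** * The identity of a product of spheres has no non-surjective deformation *)

Section Deformation.
Variables (R : realType) (M : nat) (kk : 'I_M -> nat) (b : forall p, sphere R (kk p)).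
Local Notation P := (sphere_prod R kk).
Local Notation Q := {p : 'I_M & 'I_(kk p)}.
Variables (N' : nat) (QN : #|{: Q}| = N'.+1).
Local Notation N := N'.+1.

Let tg p (i : 'I_(kk p)) : Q := Tagged (fun p => 'I_(kk p)) i.
Let ev (q : 'I_N) : Q := enum_val (cast_ord (esym QN) q).
Let rk (x : Q) : 'I_N := cast_ord QN (enum_rank x).
Let rkK x : ev (rk x) = x.
Proof. by rewrite /ev /rk cast_ordK enum_rankK. Qed.
Let evK q : rk (ev q) = q.
Proof. by rewrite /ev /rk enum_valK cast_ordKV. Qed.

(* The pole [sg p] times the first basis vector is different from [b p]. *)
Let sg (p : 'I_M) : R := if 0 < \val (b p) 0 0 then -1 else 1.

Let sg_sqr p : sg p * sg p = 1.
Proof. by rewrite /sg; case: ifP => _; rewrite ?mulrNN mulr1. Qed.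

Let sg_b p : sg p * \val (b p) 0 0 <= 0.
Proof.
by rewrite /sg; case: ltP => [/ltW|]; rewrite ?mul1r // mulN1r oppr_le0.
Qed.

Let coord (y : P) (x : Q) : R := \val (y (tag x)) 0 (lift ord0 (tagged x)).
(** The product of the open hemispheres around the poles. By [sg_b], a point with some coordinate
    [b p] lies outside. *)
Let in_core (y : P) := [forall p, 0 < sg p * \val (y p) 0 0].
Let label (y : P) : nat :=
  if in_core y then find (fun q => coord y (ev q) < 0) (enum 'I_N) else N.+1.

Let entry_continuous p j : continuous (fun y : P => \val (y p) 0 j).
Proof.
apply: cont_atP => y; apply: cont_at_entry; apply: cont_at_val.
by apply: (@cont_at_coord _ _ _ (fun y : P => y)); exact: cvg_id.
Qed.

Let find_le (y : P) : (find (fun q => (coord y (ev q) < 0)%R) (enum 'I_N) <= N)%N.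
Proof. by rewrite -[X in (_ <= X)%N](size_enum_ord N) find_size. Qed.

Let label_le y : (label y <= N.+1)%N.
Proof. by rewrite /label; case: ifP => // _; apply: leqW. Qed.

Let sg_continuous p : continuous (fun y : P => sg p * \val (y p) 0 0).
Proof.
apply: cont_atP => y; apply: cont_at_mul; first exact: cont_at_cst.
exact: entry_continuous.
Qed.

(** Inside the core the label [N.+1] is avoided, and where some factor is strictly in the opposite
    hemisphere, 0 is avoided. Otherwise some factor is on its equator and has a nonzero coordinate
    there: if it is negative, [N] is avoided, and if it is positive, its own index is avoided. *)
Let label_local (y : P) :
  exists2 c, (c <= N.+1)%N & \forall y' \near y, label y' != c.
Proof.
have [yc|/forallPn[p]] := boolP (in_core y).
  exists N.+1 => //.
  have : \forall y' \near y, forall p, 0 < sg p * \val ((y' : P) p) 0 0.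
    apply: (@filter_forall P _ (fun p y' => 0 < sg p * \val (y' p) 0 0) (nbhs y)) => p.
    apply: (cont_at_gt _ (@sg_continuous p y)).
    exact: (forallP yc).
  apply: filterS => y' /forallP y'c; rewrite /label /in_core y'c.
  by rewrite neq_ltn ltnS find_le.
rewrite -leNgt le_eqVlt => /predU1P[y0|y0]; last first.
  exists 0%N => //.
  have : \forall y' \near y, sg p * \val ((y' : P) p) 0 0 < 0.
    by apply: (cont_at_lt _ (@sg_continuous p y)).
  apply: filterS => y' y'0; rewrite /label ifF //.
  by apply/negbTE/forallPn; exists p; rewrite -leNgt ltW.
have yp0 : \val (y p) 0 0 = 0.
  by have := congr1 (fun u => sg p * u) y0; rewrite mulrA sg_sqr mul1r mulr0.
have [i yi] : exists i, \val (y p) 0 (lift ord0 i) != 0.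
  apply/existsP; apply: contraT => /existsPn yi.
  have := sphere_unit (y p); rewrite /dot big_ord_recl yp0 mul0r add0r big1.
    by move/esym/eqP; rewrite oner_eq0.
  by move=> i _; rewrite (eqP (negbNE (yi i))) mul0r.
pose q := rk (tg i).
have qE (y' : P) : coord y' (ev q) = \val (y' p) 0 (lift ord0 i).
  by rewrite /q rkK.
have qN := ltn_ord q.
case: (ltgtP (\val (y p) 0 (lift ord0 i)) 0) yi => // y'i _.
  exists N => //.
  have : \forall y' \near y, \val ((y' : P) p) 0 (lift ord0 i) < 0.
    by apply: (cont_at_lt _ (@entry_continuous p (lift ord0 i) y)).
  apply: filterS => y' y'0; rewrite /label; case: ifP => // _; last first.
    by rewrite neq_ltn ltnSn orbT.
  rewrite neq_ltn -[X in (_ < X)%N](size_enum_ord N) -has_find.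
  by apply/orP; left; apply/hasP; exists q; rewrite ?mem_enum // qE.
exists q; first by rewrite leqW // ltnW.
have : \forall y' \near y, 0 < \val ((y' : P) p) 0 (lift ord0 i).
  by apply: (cont_at_gt _ (@entry_continuous p (lift ord0 i) y)).
apply: filterS => y' y'0; rewrite /label; case: ifP => _; last first.
  by rewrite neq_ltn (leq_trans qN) ?orbT.
apply/eqP => fq; have := @nth_find _ q (fun q => coord y' (ev q) < 0) (enum 'I_N).
rewrite fq nth_ord_enum qE has_find fq size_enum_ord => /(_ qN).
by rewrite ltNge ltW.
Qed.

Let ang (th : 'rV[R]_N) (x : Q) : R := th 0 (rk x).
Let wt (th : 'rV[R]_N) (p : 'I_M) : R :=
  \sum_(i < kk p) `|ang th (tg i)|.

(* A map from R^N, 2-periodic on [-1,1]^N, that hits the core only near the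
   origin, where it is a chart. *)
Let pre (th : 'rV[R]_N) (p : 'I_M) : 'rV[R]_(kk p).+1 :=
  \row_j (if unlift ord0 j is Some i then
            let a := ang th (tg i) in a * (1 - `|a|)
          else sg p * (1 / 2 - 2 * wt th p)).

Let pre0 th p : pre th p 0 0 = sg p * (1 / 2 - 2 * wt th p).
Proof. by rewrite mxE unlift_none. Qed.

Let preS th p i : pre th p 0 (lift ord0 i) =
  let a := ang th (tg i) in a * (1 - `|a|).
Proof. by rewrite mxE liftK. Qed.

(** At a zero all angles of factor [p] have absolute value 0 or 1, so [wt th p] is a natural number
    [n] with [4 * n = 1], which is impossible. *)
Let pre_neq0 th p : pre th p != 0.
Proof.
apply/eqP => z.
have a01 (i : 'I_(kk p)) : `|ang th (tg i)| =
    (ang th (tg i) != 0)%:R.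
  have := @preS th p i; rewrite z mxE /=; set a := ang _ _ => /esym/eqP.
  rewrite mulf_eq0; have [->|_ /=] := eqVneq a 0; first by rewrite normr0.
  by rewrite subr_eq0 => /eqP.
have := pre0 th p; rewrite z mxE /wt; under eq_bigr do rewrite a01.
rewrite -natr_sum; set n := (\sum_i _)%N.
move=> /esym/(congr1 (fun u => sg p * u)); rewrite mulrA sg_sqr mul1r mulr0.
move=> e; have /eqP : (4 * n)%:R = 1%:R :> R by rewrite natrM; lra.
rewrite eqr_nat => /eqP; lia.
Qed.

Let tor (th : 'rV[R]_N) : P := fun p => normalize (pre th p).

Let ang_continuous x : continuous (fun th => ang th x).
Proof. exact: coord_continuous. Qed.

Let tor_continuous : continuous tor.
Proof.
apply: cont_atP => th; apply: cont_at_prod => p; apply: cont_at_normalize => //.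
have ca x : cont_at (fun th => ang th x) th by apply: ang_continuous.
apply: cont_at_rV => j; have [i ->|->] := unliftP ord0 j.
  apply: (@cont_at_near _ _ _
    (fun th => ang th (tg i) * (1 - `|ang th (tg i)|))).
    by near=> y; rewrite preS.
  apply: cont_at_mul; first exact: ca.
  apply: cont_at_add; first exact: cont_at_cst.
  by apply: cont_at_opp; apply: cont_at_norm.
apply: (@cont_at_near _ _ _ (fun th => sg p * (1 / 2 - 2 * wt th p))).
  by near=> y; rewrite pre0.
apply: cont_at_mul; first exact: cont_at_cst.
apply: cont_at_add; first exact: cont_at_cst.
apply: cont_at_opp; apply: cont_at_mul; first exact: cont_at_cst.
by apply: cont_at_sum => i; apply: cont_at_norm.
Unshelve. all: by end_near. Qed.

Let tor_scale th p : exists2 c : R, 0 < c & \val (tor th p) = c *: pre th p.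
Proof.
exists (Num.sqrt (dot (pre th p) (pre th p)))^-1; last by rewrite /tor val_normalize ?pre_neq0.
by rewrite invr_gt0 sqrtr_gt0 dot_gt0.
Qed.

Let core_tor th : in_core (tor th) = [forall p, wt th p < 1 / 4].
Proof.
apply: eq_forallb => p; have [c c0 ->] := tor_scale th p.
rewrite mxE mulrCA pre0 [sg p * (sg p * _)]mulrA sg_sqr mul1r pmulr_rgt0 //.
by apply/idP/idP; lra.
Qed.

Let coord_tor th x : (coord (tor th) x < 0) = (ang th x * (1 - `|ang th x|) < 0).
Proof.
rewrite /coord; have [c c0 ->] := tor_scale th (tag x).
rewrite mxE pmulr_rlt0 // preS; by case: x.
Qed.

(** Both quantities compared take equal values at the angles -1 and 1, so [tor] identifies opposite
    sides of the cube. *)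
Let tor_ext (th th' : 'rV[R]_N) :
  (forall q, `|th 0 q| = `|th' 0 q| /\
     th 0 q * (1 - `|th 0 q|) = th' 0 q * (1 - `|th' 0 q|)) -> tor th = tor th'.
Proof.
move=> e; apply: functional_extensionality_dep => p; congr normalize.
apply/rowP => j; rewrite !mxE; case: unliftP => [i|] _.
  by case: (e (rk (@tg p i))).
by congr (_ * (_ - _ * _)); apply: eq_bigr => i _; case: (e (rk (@tg p i))).
Qed.


Variable K : P * R -> P.
Hypotheses (cK : continuous K) (K0 : forall x, K (x, 0) = x).
Hypothesis K1 : forall x, exists p, K (x, 1) p = b p.

Let B : set ('rV[R]_N * R) :=
  [set v : 'rV[R]_N | forall q, `[(-1 : R), 1]%classic (v ord0 q)] `*`
  `[(0 : R), 1]%classic.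

Let good (h : nat) (z : 'rV[R]_N * R) := exists2 c, (c <= N.+1)%N &
  forall (th : 'rV[R]_N) t, (forall q, `|th 0 q - z.1 0 q| <= h.+1%:R^-1) ->
    `|t - z.2| <= h.+1%:R^-1 -> label (K (tor th, t)) != c.

(** A Lebesgue number argument: compactness of [B] makes the neighbourhoods of [label_local]
    uniform. *)
Let good_near : \forall h \near \oo, B `<=` good h.
Proof.
have cB : compact B.
  apply: compact_setX; last exact: segment_compact.
  apply: (@rV_compact R N (fun=> `[(-1 : R), 1]%classic)) => q.
  exact: segment_compact.
apply: ((compact_near_coveringP B).1 cB) => z _.
have [c cN lc] := label_local (K (tor z.1, z.2)).
have cKz : cont_at (fun z : 'rV[R]_N * R => K (tor z.1, z.2)) z.
  apply: (@cont_at_comp _ _ _ (fun z : 'rV[R]_N * R => (tor z.1, z.2)) K); last exact: cK.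
  apply: cont_at_pair; last exact: cvg_snd.
  apply: (@cont_at_comp _ _ _ (fun z : 'rV[R]_N * R => z.1) tor); first exact: cvg_fst.
  exact: tor_continuous.
have [[U V] /= [Uz Vz] UV] := cKz _ lc.
have [/= r r0 rU] := (nbhs_ballP _ _).1 Uz.
have [/= r' r'0 rV] := (nbhs_ballP _ _).1 Vz.
have near1 : \forall z' \near z, forall q, `|z.1 0 q - (z' : 'rV[R]_N * R).1 0 q| < r / 2.
  apply: (@filter_forall ('rV[R]_N * R) _ 
    (fun q z' => `|z.1 0 q - z'.1 0 q| < r / 2) (nbhs z)) => q.
  apply: (@cont_at_lt _ _ (fun z' : 'rV[R]_N * R => `|z.1 0 q - z'.1 0 q|)).
    by rewrite subrr normr0 divr_gt0.
  apply: cont_at_norm; apply: cont_at_add; first exact: cont_at_cst.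
  by apply: cont_at_opp; apply: cont_at_entry; exact: cvg_fst.
have near2 : \forall z' \near z, `|z.2 - (z' : 'rV[R]_N * R).2| < r' / 2.
  apply: (@cont_at_lt _ _ (fun z' : 'rV[R]_N * R => `|z.2 - z'.2|)).
    by rewrite subrr normr0 divr_gt0.
  apply: cont_at_norm; apply: cont_at_add; first exact: cont_at_cst.
  by apply: cont_at_opp; exact: cvg_snd.
(* One half of the radius pays for the distance from [z] to [z'], the other for the mesh. *)
have r2 : 0 < r / 2 by rewrite divr_gt0.
have r'2 : 0 < r' / 2 by rewrite divr_gt0.
near=> z' h.
have zz1 : forall q, `|z.1 0 q - z'.1 0 q| < r / 2 by near: z'.
have zz2 : `|z.2 - z'.2| < r' / 2 by near: z'.
have h1 : h.+1%:R^-1 < r / 2 by near: h; exact: (near_infty_natSinv_lt (PosNum r2)).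
have h2 : h.+1%:R^-1 < r' / 2 by near: h; exact: (near_infty_natSinv_lt (PosNum r'2)).
exists c => // th t thz tz.
apply: (UV (th, t)); split => /=.
  apply: rU; split => // a q; rewrite ord1 /ball /= -(subrKA (z'.1 0 q)).
  apply: le_lt_trans (ler_normD _ _) _; rewrite (splitr r) ltrD //.
  by rewrite distrC; apply: le_lt_trans (thz q) _.
apply: rV; rewrite /ball /= -(subrKA z'.2).
apply: le_lt_trans (ler_normD _ _) _; rewrite (splitr r') ltrD //.
by rewrite distrC; apply: le_lt_trans tz _.
Unshelve. all: by end_near. Qed.

Section Grid.
Variable h : nat.
Local Notation grid := {ffun 'I_N -> 'I_(h.+1.*2)}.

Let tau (v : grid) : 'rV[R]_N := \row_q ((v q)%:R / h.+1%:R - 1).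

Let h0 : 0 < h.+1%:R :> R. Proof. by rewrite ltr0n. Qed.

Let tau_itv (v : grid) q : -1 <= tau v 0 q <= 1.
Proof.
rewrite mxE lerDr divr_ge0 ?ler0n //= lerBlDr ler_pdivrMr //.
rewrite (_ : 1 + 1 = 2%:R) // -natrM ler_nat.
by have := ltn_ord (v q); lia.
Qed.

Let tau_lt0 (v : grid) q : (tau v 0 q < 0) = (v q < h.+1)%N.
Proof. by rewrite mxE subr_lt0 ltr_pdivrMr // mul1r ltr_nat. Qed.

(** A coordinate that wraps around lands at -1 instead of 1, which [tor] does not see. So all
    vertices may be taken within one mesh width of [tau S.1]. *)
Let tor_vtx (S : grid * {perm 'I_N}) i :
  tor (tau (vtx S i)) =
  tor (\row_q (tau S.1 0 q + (S.2 q < i)%:R / h.+1%:R)).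
Proof.
apply: tor_ext => q; rewrite !mxE !ffunE; case: ifP => _; last first.
  by rewrite mul0r addr0.
have [wrap|nowrap] := eqVneq (S.1 q).+1 (h.+1.*2); last first.
  rewrite /= modn_small; last by rewrite ltn_neqAle nowrap ltn_ord.
  by rewrite -natr1 mulrDl addrAC.
have -> : (ordS (S.1 q) : nat)%:R = 0 :> R by rewrite /= wrap modnn.
have -> : (S.1 q)%:R / h.+1%:R - 1 + true%:R / h.+1%:R = 1 :> R.
  rewrite addrAC -mulrDl natr1 wrap -addnn natrD mulrDl divff ?addrK ?gt_eqF //.
by rewrite mul0r sub0r normrN normr1 subrr !mulr0.
Qed.

Let core (v : grid) := in_core (tor (tau v)).

(** On the core all angles are below 1/4 in absolute value, so [label] is [first_below] there. The
    last grid value has angle [1 - 1 / h.+1 >= 1 / 2] and stays out of the core; the middle cell has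
    weights at most [kk p / h.+1 < 1 / 4] and lies in it. *)
Lemma full_count_torus :
  (forall p, (4 * kk p < h.+1)%N) -> (0 < h)%N ->
  full_count (fun v : grid => label (tor (tau v))) = true.
Proof.
move=> kh hpos.
have core_small v q : core v -> `|tau v 0 q| < 1 / 4.
  rewrite /core core_tor => /forallP/(_ (tag (ev q))); apply: le_lt_trans.
  rewrite /wt (bigD1 (tagged (ev q))) //= (_ : ang _ _ = tau v 0 q); last first.
    by rewrite /ang /tg; case: (ev q) (evK q) => p i /= <-.
  by rewrite lerDl sumr_ge0.
rewrite -(@full_count_first_below N' h core).
- rewrite /full_count; apply: eq_bigr => S _; congr (full _ _); apply: eq_map => i.
  rewrite /label -/(core _); case: ifP => // cv; apply: eq_find => q.
  rewrite coord_tor /ang evK pmulr_llt0 ?tau_lt0 //.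
  by have := @core_small _ q cv; rewrite subr_gt0; lra.
- move=> v q /(@core_small v q); apply: contraTneq => vq; rewrite mxE -leNgt.
  have -> : (v q)%:R = 2 * h.+1%:R - 1 :> R.
    by apply/eqP; rewrite eq_sym subr_eq natr1 vq -muln2 natrM mulrC.
  rewrite mulrBl mulfK ?gt_eqF // ; apply: le_trans (ler_norm _).
  have : 1 / h.+1%:R <= 1 / 2 :> R.
    by rewrite !mul1r lef_pV2 ?posrE // ler_nat.
  by move: (1 / h.+1%:R) => u; lra.
move=> v vh; rewrite /core core_tor; apply/forallP => p.
apply: (@le_lt_trans _ _ (\sum_(i < kk p) h.+1%:R^-1)).
  apply: ler_sum => i _; rewrite /ang mxE.
  case: (vh (rk (tg i))) => ->; last by rewrite divff ?gt_eqF // subrr normr0 invr_ge0 ltW.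
  have -> : h%:R / h.+1%:R - 1 = - h.+1%:R^-1 :> R.
    rewrite -[h%:R in LHS](addrK 1) natr1 mulrBl divff ?gt_eqF // mul1r.
    by rewrite addrAC subrr add0r.
  by rewrite normrN ger0_norm // invr_ge0 ltW.
rewrite sumr_const card_ord -[_^-1 *+ _]mulr_natl ltr_pdivrMr //.
have : (4 * kk p)%:R < h.+1%:R :> R by rewrite ltr_nat.
rewrite natrM; lra.
Qed.


(** Moving along [K] in time steps of [1 / h.+1] preserves the parity. It is odd at time 0, where
    [K] is the identity, but at time 1 every label is [N.+1]. *)
Lemma grid_contradiction : (forall p, (4 * kk p < h.+1)%N) -> (0 < h)%N ->
  B `<=` good h -> False.
Proof.
move=> kh hpos Bgood.
pose la (j : nat) (v : grid) := label (K (tor (tau v), j%:R / h.+1%:R)).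
have hom : full_count (la 0%N) = full_count (la h.+1).
  apply: full_count_homotopy => [j v|j S jh]; first exact: label_le.
  have [|c cN Sc] := Bgood (tau S.1, j%:R / h.+1%:R).
    split => /= [q|]; rewrite in_itv /= ?tau_itv //.
    by rewrite divr_ge0 ?ler0n //= ler_pdivrMr // mul1r ler_nat ltnW.
  exists c => // i _; rewrite /la tor_vtx.
  have close q : `|(\row_q (tau S.1 0 q + (S.2 q < i)%:R / h.+1%:R) : 'rV[R]_N) 0 q -
      tau S.1 0 q| <= h.+1%:R^-1.
    rewrite [in X in X - _]mxE addrAC subrr add0r ger0_norm ?divr_ge0 ?ler0n //.
    by case: (_ < _)%N; rewrite ?mul1r // mul0r invr_ge0 ltW.
  apply/andP; split; apply: Sc => //=; first by rewrite subrr normr0 invr_ge0 ltW.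
  by rewrite -mulrBl -natr1 addrAC subrr add0r mul1r ger0_norm // invr_ge0 ltW.
have la0 : full_count (la 0%N) = true.
  rewrite -(full_count_torus kh hpos); congr full_count.
  by apply/funext => v; rewrite /la mul0r K0.
move: hom; rewrite la0 /full_count big1 // => S _.
have laT v : la h.+1 v = N.+1.
  rewrite /la divff ?gt_eqF // /label ifF //; have [p Kp] := K1 (tor (tau v)).
  by apply/negbTE/forallPn; exists p; rewrite Kp -leNgt.
apply/negbTE/negP => /perm_mem/(_ 0%N).
by rewrite [in RHS]mem_iota => /mapP[i _]; rewrite laT.
Qed.

End Grid.

Lemma no_deformation : False.
Proof.
near \oo => h; apply: (@grid_contradiction h).
- near: h; apply: filter_forall => p; near=> h; apply: leqW; near: h.
  exact: nbhs_infty_gt.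
- by near: h; exact: nbhs_infty_gt.
- by near: h; exact: good_near.
Unshelve. all: by end_near. Qed.

End Deformation.

(** * Coverings by open sets with contractible projections *)

Lemma near_open_comp (T U : topologicalType) (f : T -> U) (A : set U) (x : T) :
  open A -> A (f x) -> cont_at f x -> \forall y \near x, A (f y).
Proof. by move=> oA Afx; apply; apply: open_nbhs_nbhs. Qed.

Definition clamp01 (R : realType) (t : R) : R := Num.min 1 (Num.max 0 t).

Lemma clamp01_cont (R : realType) (T : topologicalType) (f : T -> R) x :
  cont_at f x -> cont_at (fun y => clamp01 (f y)) x.
Proof.
by move=> cf; apply: cont_at_min; [|apply: cont_at_max => //]; exact: cont_at_cst.
Qed.

Lemma clamp01_itv (R : realType) (t : R) : 0 <= clamp01 t <= 1.
Proof. by rewrite le_min ler01 le_max lexx /= ge_min lexx. Qed.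

Lemma clamp01_0 (R : realType) (t : R) : t <= 0 -> clamp01 t = 0.
Proof. by move=> t0; rewrite /clamp01 (max_l t0) min_r. Qed.

Lemma clamp01_1 (R : realType) (t : R) : 1 <= t -> clamp01 t = 1.
Proof.
by move=> t1; rewrite /clamp01 max_r ?min_l // (le_trans _ t1).
Qed.

Section SphereProductCategory.
Variables (R : realType) (M : nat) (kk : 'I_M -> nat) (b : forall p, sphere R (kk p)).
Local Notation P := (sphere_prod R kk).

Lemma sphere_prod_compact : compact [set: P].
Proof.
have := @tychonoff _ (fun p => sphere R (kk p)) (fun p => setT)
  (fun p => @sphere_compact R (kk p)).
by congr compact; apply/seteqP; split.
Qed.

Lemma sphere_prod_cover : cover_compact [set: P].
Proof.
pose PP : ptopologicalType := HB.pack (Topological.sort P) (isPointed.Build P b).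
by rewrite -(@compact_cover PP); exact: sphere_prod_compact.
Qed.

Lemma sphere_prod_hausdorff : hausdorff_space P.
Proof. by apply: hausdorff_product => p; exact: sphere_hausdorff. Qed.

Lemma sphere_prod_separator (A : set P) (x : P) : open A -> A x ->
  exists f : P -> R, [/\ continuous f, forall y, 0 <= f y, f x = 1 &
    forall y, ~ A y -> f y = 0].
Proof.
move=> oA Ax.
have nP := compact_normal sphere_prod_hausdorff sphere_prod_compact.
have crP := @normal_completely_regular R P nP
  (hausdorff_accessible sphere_prod_hausdorff).
have nAx : ~ (~` A) x by move=> /(_ Ax).
have /(@uniform_separatorP P R) [f [cf f01 fx fA]] := crP x _ (open_closedC oA) nAx.
exists (fun y => 1 - f y); split.
- apply: cont_atP => y; apply: cont_at_add; first exact: cont_at_cst.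
  by apply: cont_at_opp; exact: cf.
- move=> y; have /f01 /= : range f (f y) by exists y.
  by rewrite in_itv /= subr_ge0 => /andP[].
- by rewrite (fx (f x)) ?subr0 //; exists x.
- by move=> y nAy; rewrite (fA (f y)) ?subrr //; exists y.
Qed.

Lemma no_contractible_cover (U : 'I_M -> set P)
    (h : forall p, P * R -> sphere R (kk p)) :
  (0 < M)%N -> (forall p, 0 < kk p)%N ->
  (forall p, open (U p)) -> (forall x, exists p, U p x) ->
  (forall p x t, U p x -> cont_at (h p) (x, t)) ->
  (forall p x, U p x -> h p (x, 0) = x p) ->
  (forall p x, U p x -> h p (x, 1) = b p) -> False.
Proof.
move=> M0 k0 oU covU ch h0 h1.
have /choice[g gP] : forall x, exists g : 'I_M * (P -> R), [/\ continuous g.2,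
    forall y, 0 <= g.2 y, g.2 x = 1 & forall y, ~ U g.1 y -> g.2 y = 0].
  move=> x; have [p Ux] := covU x.
  by have [f fP] := sphere_prod_separator (oU p) Ux; exists (p, f).
have /= cov : finite_subset_cover [set: P] (fun x => [set y | 1 / 2 < (g x).2 y]) [set: P].
  apply: sphere_prod_cover.
    move=> x _; rewrite openE => y /= gy; have [cg _ _ _] := gP x.
    exact: (cont_at_gt gy (cg y)).
  by move=> x _; exists x => //=; have [_ _ -> _] := gP x; lra.
have [D _ Dcov] := cov.
(* The bump functions of the finite subcover are collected by the set [U p] that supports them; at
   every point some [F p] exceeds 1/2. *)
pose F p (x : P) : R := \sum_(y : D) (if (g (fsval y)).1 == p then (g (fsval y)).2 x else 0).
have F_cont p (x : P) : cont_at (F p) x.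
  apply: cont_at_sum => y; case: ((g (fsval y)).1 == p); last exact: cont_at_cst.
  by have [cg _ _ _] := gP (fsval y); apply: cg.
have F_out p x : ~ U p x -> F p x = 0.
  move=> nU; rewrite /F big1 // => y _; case: eqP => // gp.
  by have [_ _ _ g0] := gP (fsval y); apply: g0; rewrite gp.
have F_big x : exists p, 1 / 2 < F p x.
  have [y /= Dy gy] := Dcov x I; exists (g y).1.
  rewrite /F (bigD1 [` Dy]%fset) //= eqxx; apply: lt_le_trans gy _.
  rewrite lerDl; apply: sumr_ge0 => z _; case: ifP => // _.
  by have [_ g0 _ _] := gP (fsval z).
(* The cutoff is 1 where [F p > 1 / 2] and 0 where [F p <= 1 / 4]. The latter holds near every point
   outside [U p], so the two cases of [K] fit together continuously. *)
pose phi p x : R := clamp01 (4 * F p x - 1).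
pose K (z : P * R) : P := fun p =>
  if `[< U p z.1 >] then h p (z.1, clamp01 z.2 * phi p z.1) else z.1 p.
have Kc : continuous K.
  apply: cont_atP => z; apply: cont_at_prod => p.
  have cz1 : cont_at (fun z : P * R => z.1) z by exact: cvg_fst.
  have cF : cont_at (fun z : P * R => F p z.1) z by apply: cont_at_comp cz1 _; exact: F_cont.
  have [Uz|nUz] := pselect (U p z.1).
    apply: (@cont_at_near _ _ _ (fun z => h p (z.1, clamp01 z.2 * phi p z.1))).
      have : \forall z' \near z, U p (z' : P * R).1.
        by apply: near_open_comp cz1.
      by apply: filterS => z' Uz'; rewrite /K asboolT.
    apply: (@cont_at_comp _ _ _ (fun z : P * R => (z.1, clamp01 z.2 * phi p z.1)) (h p)).
      apply: cont_at_pair => //; apply: cont_at_mul.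
        by apply: clamp01_cont; exact: cvg_snd.
      apply: clamp01_cont; apply: cont_at_add; last exact: cont_at_cst.
      by apply: cont_at_mul => //; exact: cont_at_cst.
    exact: ch.
  apply: (@cont_at_near _ _ _ (fun z : P * R => z.1 p)).
    have : \forall z' \near z, F p (z' : P * R).1 < 1 / 4.
      by apply: (cont_at_lt _ cF); rewrite F_out //; lra.
    apply: filterS => z' Fz'; rewrite /K; case: asboolP => // Uz'.
    by rewrite /phi [clamp01 (_ - 1)]clamp01_0 ?mulr0 ?h0 //; lra.
  exact: (@cont_at_coord _ _ _ (fun z : P * R => z.1) z p cz1).
have K0 x : K (x, 0) = x.
  apply: functional_extensionality_dep => p; rewrite /K /=; case: asboolP => // Ux.
  by rewrite clamp01_0 // mul0r h0.
have K1 x : exists p, K (x, 1) p = b p.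
  have [p Fp] := F_big x; exists p; rewrite /K /=.
  have Ux : U p x by apply: contrapT => /F_out F0; rewrite F0 in Fp; lra.
  by rewrite asboolT // /phi !clamp01_1 ?mul1r ?h1 //; lra.
have Q0 : (0 < #|{: {p : 'I_M & 'I_(kk p)}}|)%N.
  apply/card_gt0P; exists (Tagged (fun p => 'I_(kk p)) (Ordinal (k0 (Ordinal M0)))).
  by [].
exact: (no_deformation (esym (prednK Q0)) Kc K0 K1).
Qed.

End SphereProductCategory.

(** * Paths in the wedge of intervals and evaluation of sections *)

Section IntervalWedge.
Variables (R : realType) (s : nat).
Local Notation J := (interval_wedge R s).

Definition to_unit (t : R) : unit_interval R :=
  exist _ (clamp01 t) (mem_set (clamp01_itv t)).

Lemma to_unit_cont (T : topologicalType) (f : T -> R) x :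
  cont_at f x -> cont_at (fun y => to_unit (f y)) x.
Proof. by move=> cf; apply: cont_at_subtype; apply: clamp01_cont. Qed.

Lemma to_unit0 t : t <= 0 -> to_unit t = I0 R.
Proof. by move=> t0; apply: val_inj; rewrite /= clamp01_0. Qed.

Lemma to_unit1 t : 1 <= t -> to_unit t = I1 R.
Proof. by move=> t1; apply: val_inj; rewrite /= clamp01_1. Qed.

Definition leg (i : 'I_s) (t : unit_interval R) : J :=
  @wedge_lift _ (fun=> unit_interval R) (fun=> I0 R) i t.

Lemma unit_interval_compact : compact [set: unit_interval R].
Proof. by apply: compact_subtype; exact: segment_compact. Qed.

Lemma unit_interval_hausdorff : hausdorff_space (unit_interval R).
Proof. by apply: val_injective_hausdorff; exact: norm_hausdorff. Qed.

Lemma interval_wedge_locally_compact : locally_compact [set: J].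
Proof.
move=> x _; exists setT; first exact: filterT.
split; last exact: closedT.
apply: wedge_compact => [|i]; last exact: unit_interval_compact.
exact: finite_finset.
Qed.

Lemma interval_wedge_hausdorff : hausdorff_space J.
Proof. by apply: wedge_hausdorff => i; exact: unit_interval_hausdorff. Qed.

Lemma leg0 i j : leg i (I0 R) = leg j (I0 R).
Proof.
exact: (@wedge_liftE _ (fun=> unit_interval R) (fun=> I0 R) j (I0 R) i (I0 R)).
Qed.

(** Composed with an element of [map_space J Y], this path from end to end through the wedge point
    yields a path between the [i]-th and the [j]-th endpoint. *)
Definition detour (i j : 'I_s) (t : R) : J :=
  if t <= 1 / 2 then leg i (to_unit (1 - 2 * t)) else leg j (to_unit (2 * t - 1)).

Lemma detour_continuous i j : continuous (detour i j).
Proof.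
have lc (l : 'I_s) (f : R -> R) t : cont_at f t ->
    cont_at (fun t : R => leg l (to_unit (f t))) t.
  move=> cf; apply: (@cont_at_comp _ _ _ (fun t => to_unit (f t)) (leg l)).
    exact: to_unit_cont.
  exact: (@wedge_lift_continuous _ (fun=> unit_interval R) (fun=> I0 R)).
have c1 (t : R) : cont_at (fun t : R => leg i (to_unit (1 - 2 * t))) t.
  apply: lc; apply: cont_at_add; first exact: cont_at_cst.
  by apply: cont_at_opp; apply: cont_at_mul; [exact: cont_at_cst|exact: cont_at_id].
have c2 (t : R) : cont_at (fun t : R => leg j (to_unit (2 * t - 1))) t.
  apply: lc; apply: cont_at_add; last exact: cont_at_cst.
  by apply: cont_at_mul; [exact: cont_at_cst|exact: cont_at_id].
apply: cont_atP => t; case: (ltgtP t (1 / 2)) => [t2|t2|->].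
- apply: cont_at_near (c1 t); near=> u; rewrite /detour ifT //.
  by apply: ltW; near: u; apply: lt_nbhsl.
- apply: cont_at_near (c2 t); near=> u; rewrite /detour ifF //.
  by apply/negbTE; rewrite -ltNge; near: u; apply: lt_nbhsr.
(* At time 1/2 both formulas give the wedge point, so [W] contains the nearby values of each. *)
move=> W; rewrite {1}/detour lexx => Wt; rewrite nbhs_simpl /=.
have e1 : leg i (to_unit (1 - 2 * (1 / 2))) = leg j (to_unit (2 * (1 / 2) - 1)).
  rewrite !to_unit0 ?(leg0 i j) //; lra.
have n1 : \forall u \near (1 / 2 : R), W (leg i (to_unit (1 - 2 * u))).
  exact: (c1 _ W Wt).
have n2 : \forall u \near (1 / 2 : R), W (leg j (to_unit (2 * u - 1))).
  by apply: (c2 _ W); rewrite -e1.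
near=> u; rewrite /= /detour; case: (u <= 1 / 2); by near: u.
Unshelve. all: by end_near. Qed.

Lemma detour_0 i j : detour i j 0 = leg i (I1 R).
Proof. by rewrite /detour ifT ?to_unit1 //; lra. Qed.

Lemma detour_1 i j : detour i j 1 = leg j (I1 R).
Proof.
by rewrite /detour ifF ?to_unit1 //; [lra|apply/negbTE; rewrite -ltNge; lra].
Qed.

Variable Y : topologicalType.

(** The wedge is locally compact and Hausdorff, so a map into the compact-open topology uncurries to
    a jointly continuous one; openness of [U] removes the restriction to the subspace. *)
Lemma section_eval_cont (U : set (power_space Y s))
    (sigma : power_space Y s -> map_space J Y) z u :
  open U -> {within U, continuous sigma} -> U z ->
  cont_at (fun zu : power_space Y s * J =>
    (sigma zu.1 : continuousType J Y) zu.2) (z, u).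
Proof.
move=> oU cs Uz.
have csU : continuous (fun a : U =>
    (sigma (\val a) : continuousType J Y) : {compact-open, J -> Y}).
  apply: cont_atP => a.
  apply: (@cont_at_comp _ _ _ (fun a : U => sigma (\val a))
     (fun f : map_space J Y => (f : continuousType J Y) : {compact-open, J -> Y})).
    by move/subspace_sigL_continuousP: cs; apply.
  exact: initial_continuous.
have cu := @continuous_uncurry U J Y
  (fun a => (sigma (\val a) : continuousType J Y) : J -> Y)
  interval_wedge_locally_compact interval_wedge_hausdorff csU
  (fun a => @cts_fun _ _ (sigma (\val a) : continuousType J Y)).
move=> W Wz; rewrite nbhs_simpl /=.
have [[A B] /= [[A' [[O oO OA'] A'z A'A]] Bu] AB] := cu (exist _ z (mem_set Uz), u) W Wz.
exists (O `&` U, B) => /=.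
  split => //; apply: filterI; last by apply: open_nbhs_nbhs.
  by apply: open_nbhs_nbhs; split => //; rewrite -OA' in A'z.
move=> [z' u'] /= [[Oz' Uz'] Bu'].
have := AB (exist _ z' (mem_set Uz'), u'); apply; split => //=.
by apply: A'A; rewrite -OA'.
Qed.

End IntervalWedge.

(** * The lower bound: a product of spheres inside the power of the skeleton *)

Section LowerBound.
Variables (R : realType) (s n d : nat) (k : 'I_n -> nat).
Variable b : forall i : 'I_n, sphere R (k i).
Hypotheses (s2 : (2 <= s)%N) (k0 : forall i, (0 < k i)%N) (d1n : (1 <= d <= n)%N).
Local Notation X := (skeleton b d).
Local Notation Z := (power_space X s).
Local Notation M := (minn (s * d) ((s - 1) * n)).

Let d0 : (0 < d)%N. Proof. by case/andP: d1n. Qed.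
Let dn : (d <= n)%N. Proof. by case/andP: d1n. Qed.
Let n0 : (0 < n)%N. Proof. exact: leq_trans d0 dn. Qed.

(* Position p < M is put in row p / d and column p mod n: a row receives d
   consecutive positions, and a column at most s - 1 positions. *)
Let row_lt (p : 'I_M) : (p %/ d < s)%N.
Proof. by rewrite ltn_divLR // (leq_trans (ltn_ord p)) // geq_minl. Qed.
Let prow (p : 'I_M) : 'I_s := Ordinal (row_lt p).
Let pcol (p : 'I_M) : 'I_n := Ordinal (ltn_pmod p n0).

(** Positions in one row differ by less than [d <= n], and in one column by a multiple of [n]. *)
Let pos_inj p p' : prow p = prow p' -> pcol p = pcol p' -> p = p'.
Proof.
move=> /(congr1 val) /= r /(congr1 val) /= c; apply: val_inj => /=.
wlog pp' : p p' r c / (p <= p')%N.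
  by move=> th; case: (leqP p p') => [|/ltnW] pp'; [exact: th|symmetry; exact: th].
have dvd : (n %| p' - p)%N by rewrite -eqn_mod_dvd // c.
have : (p' - p < n)%N.
  apply: leq_trans dn; rewrite (divn_eq p d) (divn_eq p' d) r subnDl.
  by apply: leq_ltn_trans (leq_subr _ _) _; rewrite ltn_mod.
move=> lt; have /eqP : (p' - p = 0)%N.
  by apply/eqP; rewrite -leqn0 leqNgt; apply/negP => /dvdn_leq /(_ dvd); lia.
by move=> /eqP ?; lia.
Qed.

(** A position in a fixed column is determined by its quotient by [n], which is below [s.-1]. If
    column [i] had a position in each row, these quotients would inject [s] rows into [s.-1]
    values. *)
Let free_row (i : 'I_n) : exists l : 'I_s, forall p, pcol p = i -> prow p <> l.
Proof.
apply: contrapT => /forallNP nfree.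
have /choice [f fP] : forall l : 'I_s, exists p : 'I_M, pcol p = i /\ prow p = l.
  move=> l; apply: contrapT => /forallNP np; apply: (nfree l) => p pi pl.
  by apply: (np p).
have q_lt l : (f l %/ n < s.-1)%N.
  by rewrite ltn_divLR // (leq_trans (ltn_ord (f l))) // -subn1 geq_minr.
have := @leq_card _ _ (fun l : 'I_s => Ordinal (q_lt l)).
rewrite !card_ord => /(_ _)/wrap[|]; last by lia.
move=> l l' /(congr1 val) /= ll'; have [cl rl] := fP l; have [cl' rl'] := fP l'.
rewrite -rl -rl'; congr prow; apply: val_inj => /=.
rewrite (divn_eq (f l) n) (divn_eq (f l') n) ll'; congr (_ + _)%N.
by have := congr1 val (etrans cl (esym cl')).
Qed.

Let kk p := k (pcol p).
Let bb p := b (pcol p).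
Local Notation P := (sphere_prod R kk).

(** The sphere depends on the column, so [x p] has to be transported along the equality
    [pcol p = i]. *)
Let emb_coord (x : P) (l : 'I_s) (i : 'I_n) : sphere R (k i) :=
  match [pick p | (prow p == l) && (pcol p == i)] with
  | Some p => if pcol p =P i is ReflectT e then ecast j (sphere R (k j)) e (x p)
              else b i
  | None => b i
  end.

Let emb_coord_pos x p : emb_coord x (prow p) (pcol p) = x p.
Proof.
rewrite /emb_coord; case: pickP => [q /andP[/eqP qr /eqP qc]|/(_ p)]; last by rewrite !eqxx.
have qp := pos_inj qr qc; subst q; case: eqP => // e.
by rewrite (eq_axiomK e).
Qed.

Let emb_coord_out x l i : (forall p, pcol p = i -> prow p <> l) -> emb_coord x l i = b i.
Proof.
rewrite /emb_coord => np; case: pickP => // p /andP[/eqP pl /eqP pi].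
by case: (np p pi).
Qed.

Let emb_coord_cont l i : continuous (fun x : P => emb_coord x l i).
Proof.
apply: cont_atP => x; rewrite /emb_coord; case: pickP => [p _|_]; last exact: cont_at_cst.
case: eqP => e; last exact: cont_at_cst.
by case: _ / e; apply: (@cont_at_coord _ _ _ id); exact: cont_at_id.
Qed.

(** The positions in row [l] have the form [l * d + j] with [j < d], so at most [d] columns are
    occupied. *)
Let emb_skel x l : (emb_coord x l : sphere_prod R k) \in skeleton_set b d.
Proof.
rewrite inE /skeleton_set /=.
have col_lt (j : 'I_d) : ((l * d + j) %% n < n)%N by rewrite ltn_mod.
rewrite -[X in (_ <= X)%N](card_ord d).
apply: leq_trans (leq_image_card (fun j : 'I_d => Ordinal (col_lt j)) predT).
apply/subset_leq_card/fintype.subsetP => i; rewrite inE => xb.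
have [p [pi pl]] : exists p, pcol p = i /\ prow p = l.
  apply: contrapT => /forallNP np; case/eqP: xb; apply: emb_coord_out => p pi pl.
  by apply: (np p).
apply/mapP; exists (Ordinal (ltn_pmod p d0)); first by rewrite mem_enum.
by apply: val_inj; rewrite -pi /= -(congr1 val pl) /= -divn_eq.
Qed.

Let emb (x : P) : Z := fun l => exist _ (emb_coord x l : sphere_prod R k) (emb_skel x l).

Let emb_cont : continuous emb.
Proof.
apply: cont_atP => x; apply: cont_at_prod => l; apply: cont_at_subtype.
by apply: cont_at_prod => i; exact: emb_coord_cont.
Qed.

Lemma TC_cover_lower m : TC_cover R s X m -> (M <= m)%N.
Proof.
move=> [U [oU covU secU]]; rewrite leqNgt; apply/negP => mM.
have /choice[sigma sigmaP] := secU.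
have /choice[fr frP] := free_row.
pose sec (p : 'I_M) := sigma (inord p).
(* The [m.+1 <= M] sets of the cover are padded by empty sets, so that there is one set for each
   position. *)
pose V (p : 'I_M) : set P := [set x | (p <= m)%N /\ U (inord p) (emb x)].
have ppos (p : 'I_M) : (0 < M)%N by apply: leq_ltn_trans (ltn_ord p).
(* Over [V p] the section joins the point in row [prow p] to the one in a row that is free in column
   [pcol p]. Read in that column, this is a path from [x p] to the base point. *)
pose h (p : 'I_M) (z : P * R) : sphere R (kk p) :=
  \val ((sec p (emb z.1) : continuousType (interval_wedge R s) X)
    (detour (prow p) (fr (pcol p)) z.2)) (pcol p).
have end_ p x l : V p x -> \val ((sec p (emb x) : continuousType (interval_wedge R s) X)
    (leg l (I1 R))) (pcol p) = emb_coord x l (pcol p).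
  move=> [_ Vx]; have [_ /(_ _ Vx) e] := sigmaP (inord p).
  by have := congr1 (fun y : Z => \val (y l) (pcol p)) e.
apply: (@no_contractible_cover R M kk bb V h).
- exact: leq_ltn_trans mM.
- by move=> p; apply: k0.
- move=> p; have [pm|pm] := boolP (p <= m)%N; last first.
    rewrite (_ : V p = set0); first exact: open0.
    by apply/seteqP; split=> // x [/(negP pm)].
  rewrite (_ : V p = emb @^-1` U (inord p)); last first.
    by apply/seteqP; split => x //= [].
  by apply: open_comp => // x _; exact: emb_cont.
- move=> x; have [j _ Uj] : (\bigcup_j U j) (emb x) by rewrite covU.
  have jM : (j < M)%N by apply: leq_ltn_trans mM; rewrite -ltnS.
  exists (Ordinal jM); split; first by rewrite /= -ltnS ltn_ord.
  by rewrite (_ : inord _ = j) //; apply: val_inj; rewrite /= inordK.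
- move=> p x t [_ Vx]; have [cs _] := sigmaP (inord p).
  pose f (z : P * R) : X := (sec p (emb z.1) : continuousType (interval_wedge R s) X)
    (detour (prow p) (fr (pcol p)) z.2).
  have cf : cont_at f (x, t).
    apply: (@cont_at_comp _ _ _
      (fun z : P * R => (emb z.1, detour (prow p) (fr (pcol p)) z.2))
      (fun zu : Z * interval_wedge R s =>
         (sec p zu.1 : continuousType (interval_wedge R s) X) zu.2)).
      apply: cont_at_pair.
        apply: (@cont_at_comp _ _ _ (fun z : P * R => z.1) emb); first exact: cvg_fst.
        exact: emb_cont.
      apply: (@cont_at_comp _ _ _ (fun z : P * R => z.2) (detour (prow p) (fr (pcol p)))).
        exact: cvg_snd.
      exact: detour_continuous.
    exact: section_eval_cont (oU _) cs Vx.
  by apply: (cont_at_coord (f := fun z => \val (f z))); apply: cont_at_val.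
- by move=> p x Vx; rewrite /h detour_0 end_ // emb_coord_pos.
- move=> p x Vx; rewrite /h detour_1 end_ // emb_coord_out // => q.
  exact: frP.
Qed.

End LowerBound.

(** * Motion planning on spheres *)

Section SpherePaths.
Variables (R : realType) (k : nat).
Implicit Types x y v : 'rV[R]_k.+1.

Lemma unit_dot_ge x y : dot x x = 1 -> dot y y = 1 -> -1 <= dot x y <= 1.
Proof.
move=> x1 y1; have := dot_ge0 (x + y); have := dot_ge0 (x + -1 *: y).
rewrite !dotDl !dotDr !dotZl !dotZr x1 y1 (dotC y x); lra.
Qed.

Lemma unit_dot_eq1 x y : dot x x = 1 -> dot y y = 1 -> dot x y = 1 -> x = y.
Proof.
move=> x1 y1 xy; apply/eqP; rewrite -subr_eq0; apply/eqP/dot_eq0.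
rewrite -scaleN1r !dotDl !dotDr !dotZl !dotZr x1 y1 (dotC y x) xy; lra.
Qed.

Lemma sphere_dot_eq1 (x y : sphere R k) : dot (\val x) (\val y) = 1 -> x = y.
Proof. by move=> xy; apply/val_inj/unit_dot_eq1 => //; exact: sphere_unit. Qed.

(* Up to normalization: from x through v to - x, then along the geodesic to y. *)
Definition half_turn x v y (u : R) : 'rV[R]_k.+1 :=
  Num.max (1 - 4 * u) (2 * u - 2) *: x + Num.max 0 (u * (1 - 2 * u)) *: v +
  Num.max 0 (2 * u - 1) *: y.

Lemma half_turn0 x v y : half_turn x v y 0 = x.
Proof.
rewrite /half_turn !mulr0 !subr0 !sub0r mul0r maxxx scale0r addr0.
by rewrite (max_l (_ : -2 <= 1)) ?(max_l (_ : -1 <= 0)) ?scale1r ?scale0r ?addr0 //; lra.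
Qed.

Lemma half_turn1 x v y : half_turn x v y 1 = y.
Proof.
rewrite /half_turn !mulr1 subrr mul1r.
have -> : Num.max (1 - 4) 0 = 0 :> R by rewrite max_r //; lra.
have -> : Num.max 0 (1 - 2) = 0 :> R by rewrite max_l //; lra.
have -> : Num.max 0 (2 - 1) = 1 :> R by rewrite max_r; lra.
by rewrite !scale0r !add0r scale1r.
Qed.

(** If [p x + q v + r y = 0], comparing norms gives [p^2 + q^2 = r^2]. For [u <= 1 / 2], [r = 0]
    forces [p = 0], hence [u = 1 / 4], where [q] is positive. For [u > 1 / 2], [q = 0] forces
    [u = 3 / 4], where the vector is [(y - x) / 2], nonzero as [dot x y < 1]. *)
Lemma half_turn_neq0 x v y u : dot x x = 1 -> dot v v = 1 -> dot x v = 0 ->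
  dot y y = 1 -> dot x y < 1 -> 0 <= u <= 1 -> half_turn x v y u != 0.
Proof.
move=> x1 v1 xv y1 xy u01; apply/eqP; rewrite /half_turn.
set p := Num.max (1 - 4 * u) _; set q := Num.max 0 (u * _); set r := Num.max 0 _ => V0.
have := congr1 (fun V => dot V x) V0; have := congr1 (fun V => dot V v) V0.
have := congr1 (fun V => dot V y) V0.
rewrite !dot0l !dotDl !dotZl x1 v1 y1 xv (dotC v x) xv (dotC y x) (dotC y v).
move: (dot x y) (dot v y) xy => c e c1 ey ev ex.
have pqr : p * p + q * q = r * r.
  have -> : p = - (r * c) by lra.
  have -> : q = - (r * e) by lra.
  have -> : r * r = r * (- (p * c + q * e)) by congr (_ * _); lra.
  have -> : p = - (r * c) by lra.
  have -> : q = - (r * e) by lra.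
  ring.
have [u2|u2] := leP u (1 / 2).
  have r0 : r = 0 by rewrite /r max_l //; lra.
  have pE : p = 1 - 4 * u by rewrite /p max_l //; lra.
  have p0 : p = 0 by move: ex; rewrite r0; lra.
  have q0 : q = 0 by move: ev; rewrite r0; lra.
  have uq : u = 1 / 4 by lra.
  by move: q0; rewrite /q uq max_r; lra.
have q0 : q = 0 by rewrite /q max_l //; nra.
have pE : p = 2 * u - 2 by rewrite /p max_r //; lra.
have rE : r = 2 * u - 1 by rewrite /r max_r //; lra.
have uE : u = 3 / 4 by move: pqr; rewrite q0 pE rE; lra.
by move: ex; rewrite q0 pE rE uE; lra.
Qed.

Lemma cont_at_half_turn (T : topologicalType) (x v y : T -> 'rV[R]_k.+1) (u : T -> R) t :
  cont_at x t -> cont_at v t -> cont_at y t -> cont_at u t ->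
  cont_at (fun s => half_turn (x s) (v s) (y s) (u s)) t.
Proof.
move=> cx cv cy cu; have c2 (c : R) : cont_at (fun s => c * u s) t.
  by apply: cont_at_mul => //; exact: cont_at_cst.
have cB (c e : R) : cont_at (fun s => c - e * u s) t.
  by apply: cont_at_add; [exact: cont_at_cst|apply: cont_at_opp].
have cS (c e : R) : cont_at (fun s => e * u s - c) t.
  by apply: cont_at_add => //; exact: cont_at_cst.
apply: cont_at_addv; first apply: cont_at_addv; apply: cont_at_scale => //;
  apply: cont_at_max => //; try exact: cont_at_cst.
exact: cont_at_mul.
Qed.

Definition partner (j : 'I_k.+1) : 'I_k.+1 := inord (if odd j then j.-1 else j.+1).

(** For odd [k] the coordinates pair up, and this is multiplication by [-i] on the complex vectors
    [x_0 + i x_1, x_2 + i x_3, ...]. *)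
Definition tangent x : 'rV[R]_k.+1 := \row_j ((-1) ^+ odd j * x 0 (partner j)).

Section Odd.
Hypothesis kodd : odd k.

Let partnerE j : partner j = (if odd j then j.-1 else j.+1) :> nat.
Proof.
rewrite /partner inordK //; have := ltn_ord j; case: ifP => oj; first by lia.
by move=> jk; rewrite ltnS ltn_neqAle -ltnS jk andbT; apply: contraFN oj => /eqP ->.
Qed.

Let odd_partner j : odd (partner j) = ~~ odd j.
Proof. by rewrite partnerE; case: ifP; lia. Qed.

Let partnerK : involutive partner.
Proof.
move=> j; apply: val_inj; rewrite /= partnerE odd_partner partnerE.
case: (boolP (odd j)) => //= oj; rewrite prednK //.
by case: (nat_of_ord j) oj.
Qed.

Lemma tangent_unit x : dot (tangent x) (tangent x) = dot x x.
Proof.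
rewrite /dot [RHS](reindex_inj (inv_inj partnerK)); apply: eq_bigr => j _.
by rewrite !mxE mulrACA -expr2 sqrr_sign mul1r.
Qed.

Lemma tangent_orth x : dot x (tangent x) = 0.
Proof.
have e : dot x (tangent x) = - dot x (tangent x).
  rewrite {1}/dot (reindex_inj (inv_inj partnerK)) -sumrN; apply: eq_bigr => j _.
  rewrite !mxE partnerK odd_partner; move: (x 0 j) (x 0 (partner j)) => a c.
  by case: (odd j); rewrite /= ?expr1 ?expr0; ring.
lra.
Qed.
End Odd.

Lemma cont_at_tangent (T : topologicalType) (x : T -> 'rV[R]_k.+1) t :
  cont_at x t -> cont_at (fun s => tangent (x s)) t.
Proof.
move=> cx; apply: cont_at_rV => j.
apply: (@cont_at_near _ _ _ (fun s => (-1) ^+ odd j * x s 0 (partner j))).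
  by near=> s; rewrite mxE.
by apply: cont_at_mul; [exact: cont_at_cst|exact: cont_at_entry].
Unshelve. all: by end_near. Qed.

(** Adding the products of a zero combination with [x] and [y] gives
    [(a + c) * (1 + dot x y) = 0]. *)
Lemma chord_neq0 x y (a c : R) : dot x x = 1 -> dot y y = 1 -> -1 < dot x y ->
  0 <= a -> 0 <= c -> 0 < a + c -> a *: x + c *: y != 0.
Proof.
move=> x1 y1 xy a0 c0 ac; apply/eqP => V0.
have := congr1 (fun V => dot V x) V0; have := congr1 (fun V => dot V y) V0.
rewrite !dot0l !dotDl !dotZl x1 y1 (dotC y x); move: (dot x y) xy => D D1 e1 e2.
have : (a + c) * (1 + D) = 0 by lra.
by apply/eqP; rewrite mulf_neq0 // gt_eqF //; lra.
Qed.

End SpherePaths.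

(** * From families of paths to sections and open covers *)

Section PathSections.
Variables (R : realType) (s : nat) (Y : topologicalType).
Local Notation J := (interval_wedge R s).
Local Notation Z := (power_space Y s).

Definition pack_cont (f : J -> Y) (cf : continuous f) : continuousType J Y :=
  HB.pack f (@isContinuous.Build J Y f cf).

Lemma section_of_paths (W : set Z)
    (g : 'I_s -> (W * unit_interval R)%type -> Y) :
  (exists y : Y, True) ->
  (forall l, continuous (g l)) ->
  (forall l l' w, g l (w, I0 R) = g l' (w, I0 R)) ->
  (forall l w, g l (w, I1 R) = \val w l) ->
  has_section_over R W.
Proof.
move=> [y0 _] cg g0 g1.
pose kk (l : 'I_s) (w : W) (t : unit_interval R) := g l (w, t).
pose G (w : W) : J -> Y := @wedge_fun _ (fun=> unit_interval R) (fun=> I0 R) _ (kk^~ w).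
have cG : continuous (uncurry G).
  apply: (@wedge_fun_joint_continuous _ (fun=> unit_interval R) (fun=> I0 R) W Y kk).
  - exact: finite_finset.
  - move=> _; apply: accessible_closed_set1; apply: hausdorff_accessible.
    exact: unit_interval_hausdorff.
  - by move=> w l l'; exact: g0.
  - move=> l; rewrite (_ : uncurry (kk l) = g l); first exact: cg.
    by apply/funext => -[].
have [cG1 cG2] := continuous_curry cG.
pose c0 : continuousType J Y := pack_cont (fun x => @cont_at_cst J Y y0 x).
(* Sections are total functions; the constant map fills in outside [W]. *)
pose sigma (z : Z) : map_space J Y :=
  if pselect (W z) is left Wz then pack_cont (cG2 (exist _ z (mem_set Wz))) else c0.
have sigmaE (w : W) : sigma (\val w) = pack_cont (cG2 w).
  rewrite /sigma; case: pselect => [Ww|]; last by case; exact: set_valP.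
  by congr (pack_cont (cG2 _)); apply: val_inj.
exists sigma; split.
  apply/subspace_sigL_continuousP; apply: cont_atP => w.
  move=> O [O' [[A oA AO'] O'w O'O]]; rewrite nbhs_simpl /=.
  have Aw : nbhs (curry (uncurry G) w : {compact-open, J -> Y}) A.
    apply: open_nbhs_nbhs; split => //.
    by move: O'w; rewrite -AO' /= /sigL /= sigmaE.
  apply: (@filterS _ (nbhs w) _ _ _ _ (cG1 w A Aw)) => w' Aw'.
  by apply: O'O; rewrite -AO' /= /sigL /= sigmaE.
move=> z Wz; apply: functional_extensionality_dep => l.
rewrite /endpoints -[z in sigma z]/(\val (exist _ z (mem_set Wz) : W)) sigmaE /=.
rewrite [curry _ _ _]wedge_lift_funE; first exact: g1.
by move=> i j; apply: g0.
Qed.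

(* For a fixed size of A the sets W A are disjoint, so that their sections glue. *)
Lemma TC_cover_of_strata (I : finType) (w : I -> Z -> R) (m : nat) :
  (exists y : Y, True) ->
  (forall a, continuous (w a)) ->
  let W (A : {set I}) : set Z :=
    [set z | (forall a c, a \in A -> c \notin A -> w c z < w a z) /\
             (forall a, a \in A -> 0 < w a z) /\ (forall c, c \notin A -> w c z < 4)] in
  (forall A z, W A z -> (#|A| <= m)%N) ->
  (forall A, has_section_over R (W A)) ->
  TC_cover R s Y m.
Proof.
move=> y0 cw W Wm secW.
have W_near A z : W A z -> \forall z' \near z, W A z'.
  move=> [W1 [W2 W3]].
  have n1 : \forall z' \near z, forall ac : I * I, ac.1 \in A -> ac.2 \notin A ->
      w ac.2 z' < w ac.1 z'.
    apply: (@filter_forall Z (I * I)%type (fun (ac : I * I) z' => ac.1 \in A -> ac.2 \notin A ->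
      w ac.2 z' < w ac.1 z') (nbhs z)) => -[a c] /=.
    have [aA|aA] := boolP (a \in A); last by near=> z'.
    have [cA|cA] := boolP (c \in A); first by near=> z'.
    have : \forall z' \near z, 0 < w a z' - w c z'.
      apply: (@cont_at_gt _ _ (fun z' => w a z' - w c z')); first by rewrite subr_gt0 W1.
      by apply: cont_at_add; [exact: cw|apply: cont_at_opp; exact: cw].
    by apply: filterS => z'; rewrite subr_gt0.
  have n2 : \forall z' \near z, forall a, a \in A -> 0 < w a z'.
    apply: (@filter_forall Z _ (fun a z' => a \in A -> 0 < w a z') (nbhs z)) => a.
    have [aA|aA] := boolP (a \in A); last by near=> z'.
    by have := cont_at_gt (W2 a aA) (cw a z); apply: filterS.
  have n3 : \forall z' \near z, forall c, c \notin A -> w c z' < 4.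
    apply: (@filter_forall Z _ (fun c z' => c \notin A -> w c z' < 4) (nbhs z)) => c.
    have [cA|cA] := boolP (c \in A); first by near=> z'.
    by have := cont_at_lt (W3 c cA) (cw c z); apply: filterS.
  near=> z'; split; last by split; near: z'.
  move=> a c; have /(_ (a, c)) : forall ac : I * I, ac.1 \in A -> ac.2 \notin A ->
      w ac.2 z' < w ac.1 z' by near: z'.
  exact.
(* Distinct sets of equal size each have an element outside the other, and [W A] and [W A'] would
   order the values of [w] at these two elements in opposite ways. *)
have W_uniq (A A' : {set I}) z : W A z -> W A' z -> #|A| = #|A'| -> A = A'.
  move=> [W1 _] [W1' _] cA; apply/eqP; rewrite eqEcard cA leqnn andbT.
  apply/fintype.subsetP => a aA; apply: contraT => aA'.
  have /fintype.subsetPn[c cA' ncA] : ~~ (A' \subset A).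
    apply: contra aA' => sub; suff -> : A' = A by [].
    by apply/eqP; rewrite eqEcard sub cA leqnn.
  by have := lt_trans (W1 _ _ aA ncA) (W1' _ _ cA' aA'); rewrite ltxx.
have /choice[sg sgP] := secW.
pose sel (j : nat) (z : Z) : {set I} :=
  odflt finset.set0 [pick A : {set I} | (#|A| == j) && `[< W A z >]].
have selE j (A : {set I}) z : #|A| = j -> W A z -> sel j z = A.
  move=> Aj WA; rewrite /sel; case: pickP => [A' /andP[/eqP A'j /asboolP WA']|/(_ A)] /=.
    by apply: (W_uniq _ _ z) => //; rewrite A'j Aj.
  by rewrite Aj eqxx asboolT.
exists (fun j : 'I_m.+1 => [set z | exists2 A : {set I}, #|A| = j & W A z]); split.
- move=> j; rewrite openE => z [A Aj WA].
  by apply: filterS (W_near A z WA) => z' WA'; exists A.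
(* Any threshold strictly between 0 and 4 would give a set [A] with [W A z]. *)
- rewrite -subTset => z _; pose A := finset (fun a => 2 <= w a z).
  have WA : W A z.
    split; first by move=> a c; rewrite !inE -ltNge => wa wc; apply: lt_le_trans wa.
    split=> a; rewrite inE -?ltNge; lra.
  have Am : (#|A| < m.+1)%N by rewrite ltnS; apply: Wm WA.
  by exists (Ordinal Am) => //; exists A.
move=> j; exists (fun z => sg (sel j z) z); split; last first.
  by move=> z [A Aj WA]; rewrite (selE j A z Aj WA); have [_] := sgP A; apply.
apply/subspace_sigL_continuousP; apply: cont_atP => v.
have [A Aj WA] := set_valP v.
(* Near [v] the selected set remains [A], so continuity is inherited from [sg A]. *)
have near_v : nbhs v (fun v' => W A (\val v')).
  by apply: initial_continuous; exact: W_near.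
have cA : cont_at (sigL (W A) (sg A)) (exist _ (\val v) (mem_set WA)).
  by have [/subspace_sigL_continuousP cs _] := sgP A; apply: cs.
move=> O; rewrite {1}/sigL /= (selE j A) // => Ov; rewrite nbhs_simpl /=.
have [B [[C oC CB] Cv BO]] := cA O Ov.
have Cn : nbhs (\val v) C by apply: open_nbhs_nbhs; split => //; move: Cv; rewrite -CB.
have near_C : nbhs v (fun v' => C (\val v')) by apply: initial_continuous.
apply: filterS2 near_v near_C => v' WA' Cv' /=; rewrite /sigL /= (selE j A) //.
have := BO (exist _ (\val v') (mem_set WA')); apply.
by rewrite -CB.
Unshelve. all: by end_near. Qed.

End PathSections.

(** * The two upper bounds: motion planners inside the skeleton *)

Section UpperBounds.
Variables (R : realType) (s n d : nat) (k : 'I_n -> nat).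
Variable b : forall i : 'I_n, sphere R (k i).
Hypothesis kodd : forall i, odd (k i).
Local Notation X := (skeleton b d).
Local Notation Z := (power_space X s).

Let pt (z : Z) (l : 'I_s) (i : 'I_n) : sphere R (k i) := \val (z l) i.

Let pt_cont (T : topologicalType) (f : T -> Z) l i x :
  cont_at f x -> cont_at (fun y => pt (f y) l i) x.
Proof.
move=> cf; apply: (cont_at_coord (f := fun y => \val (f y l))); apply: cont_at_val.
exact: (@cont_at_coord _ _ _ f x l cf).
Qed.

Let pt_skel z l : (#|[pred i | pt z l i != b i]| <= d)%N.
Proof. exact: (set_valP (z l)). Qed.

Lemma skeleton_inhabited : exists y : X, True.
Proof.
have bX : (b : sphere_prod R k) \in skeleton_set b d.
  by rewrite inE /skeleton_set /= eq_card0 // => i; rewrite !inE eqxx.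
by exists (exist _ (b : sphere_prod R k) bX).
Qed.

Lemma skeleton_section (W : set Z)
    (g : 'I_s -> forall i, (W * unit_interval R)%type -> sphere R (k i)) :
  (forall l i, continuous (g l i)) ->
  (forall l i l' w, g l i (w, I0 R) = g l' i (w, I0 R)) ->
  (forall l i w, g l i (w, I1 R) = pt (\val w) l i) ->
  (forall l x, (#|[pred i | g l i x != b i]| <= d)%N) ->
  has_section_over R W.
Proof.
move=> cg g0 g1 gd.
have gX l x : ((fun i => g l i x) : sphere_prod R k) \in skeleton_set b d.
  by rewrite inE; exact: gd.
apply: (@section_of_paths R s X W
  (fun l x => exist _ ((fun i => g l i x) : sphere_prod R k) (gX l x))).
- exact: skeleton_inhabited.
- move=> l; apply: cont_atP => x; apply: cont_at_subtype; apply: cont_at_prod => i.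
  exact: cg.
- move=> l l' w; apply: val_inj; apply: functional_extensionality_dep => i.
  exact: g0.
- move=> l w; apply: val_inj; apply: functional_extensionality_dep => i.
  exact: g1.
Qed.

Let tangent_half_turn i (x y : sphere R (k i)) (u : R) :
  dot (\val x) (\val y) < 1 -> 0 <= u <= 1 ->
  half_turn (\val x) (tangent (\val x)) (\val y) u != 0.
Proof.
move=> xy u01; apply: half_turn_neq0 => //; rewrite ?tangent_unit ?tangent_orth //;
  exact: sphere_unit.
Qed.

Let card_pairs (A : {set 'I_s * 'I_n}) :
  #|A| = (\sum_(l < s) #|[pred i | (l, i) \in A]|)%N.
Proof.
rewrite -sum1_card (eq_bigl (fun a : 'I_s * 'I_n => true && ((a.1, a.2) \in A))); last by case.
rewrite -(pair_big_dep xpredT (fun l i => (l, i) \in A) (fun _ _ => 1%N)) /=.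
by apply: eq_bigr => l _; rewrite sum1_card.
Qed.

Lemma TC_cover_dim : (0 < d)%N -> TC_cover R s X (s * d).
Proof.
move=> d0.
(* The squared distance of two unit vectors: 0 when they agree, 4 when they are antipodal. So the
   long path is available on [A] and the geodesic off [A]. *)
pose w (a : 'I_s * 'I_n) (z : Z) : R := 2 - 2 * dot (\val (b a.2)) (\val (pt z a.1 a.2)).
have wE a z : w a z = 2 - 2 * dot (\val (b a.2)) (\val (pt z a.1 a.2)) by [].
have wb a z : 0 < w a z -> pt z a.1 a.2 != b a.2.
  by move=> wa; apply/eqP => e; move: wa; rewrite wE e sphere_unit; lra.
apply: (@TC_cover_of_strata R s X _ w) => [||A z [_ [W2 _]]|A].
- exact: skeleton_inhabited.
- move=> a; apply: cont_atP => z; apply: cont_at_add; first exact: cont_at_cst.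
  apply: cont_at_opp; apply: cont_at_mul; first exact: cont_at_cst.
  apply: cont_at_dot; first exact: cont_at_cst.
  by apply: cont_at_val; apply: pt_cont; exact: cont_at_id.
- rewrite card_pairs -[s in X in (_ <= X)%N]card_ord -sum_nat_const; apply: leq_sum => l _.
  apply: leq_trans (pt_skel z l); apply/subset_leq_card/fintype.subsetP => i.
  by rewrite !inE => /W2 /wb.
set W := (X in has_section_over R X).
pose tm (x : (W * unit_interval R)%type) : R := \val x.2.
pose g (l : 'I_s) i (x : (W * unit_interval R)%type) : sphere R (k i) :=
  let y := pt (\val x.1) l i in
  if (l, i) \in A
  then normalize (half_turn (\val (b i)) (tangent (\val (b i))) (\val y) (clamp01 (2 * tm x)))
  else normalize ((1 - clamp01 (2 * tm x - 1)) *: \val (b i) +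
                  clamp01 (2 * tm x - 1) *: \val y).
have tm_cont x : cont_at tm x.
  by apply: cont_at_val; exact: cvg_snd.
have ptx_cont l i x :
    cont_at (fun x : (W * unit_interval R)%type => \val (pt (\val x.1) l i)) x.
  by apply: cont_at_val; apply: pt_cont; apply: cont_at_val; exact: cvg_fst.
have g_early l i x : (l, i) \notin A -> tm x <= 1 / 2 -> g l i x = b i.
  move=> liA t2; rewrite /g (negbTE liA) clamp01_0 ?subr0 ?scale0r ?addr0; last by lra.
  by rewrite normalize_scale.
have dotA (x : W) l i : (l, i) \in A -> dot (\val (b i)) (\val (pt (\val x) l i)) < 1.
  by move=> liA; have [_ [/(_ _ liA) + _]] := set_valP x; rewrite wE /=; lra.
have dotB (x : W) l i : (l, i) \notin A -> -1 < dot (\val (b i)) (\val (pt (\val x) l i)).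
  by move=> liA; have [_ [_ /(_ _ liA)]] := set_valP x; rewrite wE /=; lra.
apply: (@skeleton_section W g).
- move=> l i; apply: cont_atP => x; rewrite /g; have [liA|liA] := boolP ((l, i) \in A).
    apply: cont_at_normalize.
      by apply: tangent_half_turn; [exact: dotA|exact: clamp01_itv].
    apply: cont_at_half_turn; try exact: cont_at_cst; first exact: ptx_cont.
    by apply: clamp01_cont; apply: cont_at_mul; [exact: cont_at_cst|exact: tm_cont].
  have cc : cont_at (fun x => clamp01 (2 * tm x - 1)) x.
    apply: clamp01_cont; apply: cont_at_add; last exact: cont_at_cst.
    by apply: cont_at_mul; [exact: cont_at_cst|exact: tm_cont].
  apply: cont_at_normalize.
    have := clamp01_itv (2 * tm x - 1) => /andP[c0 c1].
    by apply: chord_neq0; rewrite ?sphere_unit ?subr_ge0 ?subrK //; exact: dotB.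
  apply: cont_at_addv; apply: cont_at_scale => //; try exact: cont_at_cst.
  by apply: cont_at_add; [exact: cont_at_cst|apply: cont_at_opp].
- suff g0 l i v : g l i (v, I0 R) = b i by move=> l i l' v; rewrite !g0.
  have [liA|liA] := boolP ((l, i) \in A); last by apply: g_early => //; rewrite /tm /=; lra.
  rewrite /g liA /tm /= mulr0 clamp01_0 // half_turn0 -[\val _]scale1r.
  by rewrite normalize_scale.
- move=> l i v; rewrite /g /tm /=; case: ifP => _.
    rewrite mulr1 clamp01_1 ?half_turn1; last by lra.
    by rewrite -[\val _]scale1r normalize_scale.
  rewrite mulr1 clamp01_1 ?subrr ?scale0r ?add0r; last by lra.
  by rewrite normalize_scale.
(* A coordinate whose endpoint is the base point is not in [A], and its geodesic is constant; so no
   path has more nonbase coordinates than its endpoint. *)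
move=> l x; apply: leq_trans (pt_skel (\val x.1) l).
apply/subset_leq_card/fintype.subsetP => i; rewrite !inE => gb.
have [liA|liA] := boolP ((l, i) \in A).
  by have [_ [/(_ _ liA) /wb]] := set_valP x.1.
apply: contra gb => /eqP yb; rewrite /g (negbTE liA) yb -scalerDl subrK.
by rewrite normalize_scale.
Qed.

(* The coordinate leaves x at time 1/2 - rho x and reaches y at time 1/2 + rho y,
   so it stays at b before time 1/2 when x = b, and after it when y = b. *)
Let rho i (x : sphere R (k i)) : R := (1 - dot (\val x) (\val (b i))) / 4.
Let wx i (y : sphere R (k i)) t := Num.max 0 (1 / 2 + rho y - t).
Let wy i (x : sphere R (k i)) t := Num.max 0 (t - 1 / 2 + rho x).
(** For [x = y = b i] the weights [wx] and [wy] both vanish at time 1/2. This third weight, toward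
    [b i], keeps the chord nonzero there; it vanishes at both ends of the path and unless [x] and
    [y] are close to [b i]. *)
Let wb i (x y : sphere R (k i)) t : R := Num.max 0 (1 / 4 - rho x - rho y) * (t * (1 - t)).
Let chord i (x y : sphere R (k i)) t :=
  wx y t *: \val x + wy x t *: \val y + wb x y t *: \val (b i).
(** The fraction reparametrizes the half turn so that it obeys the same timing. For [x != y] its
    denominator is at least [rho x + rho y > 0]. *)
Let turn i (x y : sphere R (k i)) t :=
  half_turn (\val x) (tangent (\val x)) (\val y) (wy x t / (wx y t + wy x t)).

Let rho_itv i (x : sphere R (k i)) : 0 <= rho x <= 1 / 2.
Proof. by have := unit_dot_ge (sphere_unit x) (sphere_unit (b i)); rewrite /rho; lra. Qed.

Let rho_b i : rho (b i) = 0.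
Proof. by rewrite /rho sphere_unit subrr mul0r. Qed.

Let rho_gt0 i (x : sphere R (k i)) : x != b i -> 0 < rho x.
Proof.
move=> xb; have [r0 _] := andP (rho_itv x); rewrite lt_neqAle r0 andbT eq_sym.
by apply: contra xb => /eqP r; apply/eqP/sphere_dot_eq1; move: r; rewrite /rho; lra.
Qed.

Let wx_ge0 i (y : sphere R (k i)) t : 0 <= wx y t. Proof. by rewrite le_max lexx. Qed.
Let wy_ge0 i (x : sphere R (k i)) t : 0 <= wy x t. Proof. by rewrite le_max lexx. Qed.
Let wb_ge0 i (x y : sphere R (k i)) t : 0 <= t <= 1 -> 0 <= wb x y t.
Proof.
by case/andP=> t0 t1; rewrite !mulr_ge0 ?subr_ge0 // le_max lexx.
Qed.

Let wxy_ge i (x y : sphere R (k i)) t : rho x + rho y <= wx y t + wy x t.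
Proof.
have : 1 / 2 + rho y - t <= wx y t by rewrite le_max lexx orbT.
have : t - 1 / 2 + rho x <= wy x t by rewrite le_max lexx orbT.
lra.
Qed.

Let wy_early i t : t <= 1 / 2 -> wy (b i) t = 0.
Proof. by move=> t2; rewrite /wy rho_b addr0 max_l //; lra. Qed.

Let wx_late i t : 1 / 2 <= t -> wx (b i) t = 0.
Proof. by move=> t2; rewrite /wx rho_b addr0 max_l //; lra. Qed.

Let wy0 i (x : sphere R (k i)) : wy x 0 = 0.
Proof. by have := rho_itv x; rewrite /wy => ?; rewrite max_l //; lra. Qed.

Let wx1 i (y : sphere R (k i)) : wx y 1 = 0.
Proof. by have := rho_itv y; rewrite /wx => ?; rewrite max_l //; lra. Qed.

Let wx0 i (y : sphere R (k i)) : 0 < wx y 0.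
Proof. by have := rho_itv y; rewrite lt_max => ?; apply/orP; right; lra. Qed.

Let wy1 i (x : sphere R (k i)) : 0 < wy x 1.
Proof. by have := rho_itv x; rewrite lt_max => ?; apply/orP; right; lra. Qed.

Let wb0 i (x y : sphere R (k i)) : wb x y 0 = 0. Proof. by rewrite /wb mul0r mulr0. Qed.
Let wb1 i (x y : sphere R (k i)) : wb x y 1 = 0. Proof. by rewrite /wb subrr !mulr0. Qed.

Let neq_rho i (x y : sphere R (k i)) :
  dot (\val x) (\val y) < 1 -> 0 < rho x + rho y.
Proof.
move=> xy; have [rx _] := andP (rho_itv x); have [ry _] := andP (rho_itv y).
have [xb|/rho_gt0] := eqVneq x (b i); last by lra.
have [yb|/rho_gt0] := eqVneq y (b i); last by lra.
by move: xy; rewrite xb yb sphere_unit ltxx.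
Qed.

(** If [wb] is positive, then [x] and [y] lie in the hemisphere of [b i] and the product of the
    chord with [b i] is positive. If [wb] is 0, then [rho x + rho y >= 1 / 4] or [t] is an end of
    the path; either way [wx + wy > 0], and [chord_neq0] applies. *)
Let chord_path_neq0 i (x y : sphere R (k i)) t :
  -1 < dot (\val x) (\val y) -> 0 <= t <= 1 -> chord x y t != 0.
Proof.
move=> xy t01; have a0 := wx_ge0 y t; have c0 := wy_ge0 x t; have f0 := wb_ge0 x y t01.
have [/andP[rx _] /andP[ry _]] := (rho_itv x, rho_itv y).
have [f1|f1] := ltP 0 (wb x y t).
  have e0 : 0 < 1 / 4 - rho x - rho y.
    rewrite ltNge; apply/negP => e; move: f1.
    by rewrite /wb max_l // mul0r ltxx.
  apply/eqP => /(congr1 (fun V => dot V (\val (b i)))).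
  rewrite dot0l !dotDl !dotZl sphere_unit mulr1 => V0.
  have X0 : 0 <= dot (\val x) (\val (b i)) by move: e0 rx ry; rewrite /rho; lra.
  have Y0 : 0 <= dot (\val y) (\val (b i)) by move: e0 rx ry; rewrite /rho; lra.
  by have := mulr_ge0 a0 X0; have := mulr_ge0 c0 Y0; lra.
have fz : wb x y t = 0 by apply/eqP; rewrite eq_le f1 f0.
rewrite /chord fz scale0r addr0; apply: chord_neq0 => //; try exact: sphere_unit.
have := wxy_ge x y t; have [r4|r4] := ltP (rho x + rho y) (1 / 4); last by lra.
move=> _; move/eqP: fz; rewrite /wb mulf_eq0 gt_eqF ?lt_max /=; last by apply/orP; right; lra.
rewrite mulf_eq0 => /orP[/eqP ->|].
  by have := wx0 y; have := wy_ge0 x 0; lra.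
rewrite subr_eq0 => /eqP <-.
by have := wy1 x; have := wx_ge0 y 1; lra.
Qed.

Let turn_frac i (x y : sphere R (k i)) t : 0 <= wy x t / (wx y t + wy x t) <= 1.
Proof.
have a0 := wx_ge0 y t; have c0 := wy_ge0 x t.
rewrite divr_ge0 ?addr_ge0 //=.
have [e|e] := eqVneq (wx y t + wy x t) 0; first by rewrite e invr0 mulr0.
by rewrite ler_pdivrMr ?mul1r ?lerDr // lt_neqAle eq_sym e addr_ge0.
Qed.

Let turn_early i (y : sphere R (k i)) t : t <= 1 / 2 -> turn (b i) y t = \val (b i).
Proof. by move=> t2; rewrite /turn wy_early // mul0r half_turn0. Qed.

Let turn_late i (x : sphere R (k i)) t : dot (\val x) (\val (b i)) < 1 -> 1 / 2 <= t ->
  turn x (b i) t = \val (b i).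
Proof.
move=> xb t2; rewrite /turn wx_late // add0r divff ?half_turn1 //.
have := neq_rho xb; have := wxy_ge x (b i) t; rewrite wx_late // add0r => l r.
by rewrite gt_eqF // (lt_le_trans r).
Qed.

Let chord_b i (x y : sphere R (k i)) t (c : R) :
  -1 < dot (\val x) (\val y) -> 0 <= t <= 1 ->
  chord x y t = c *: \val (b i) -> 0 <= c -> normalize (chord x y t) = b i.
Proof.
move=> xy t01 e c0; have := chord_path_neq0 xy t01; rewrite e scaler_eq0 negb_or.
by case/andP=> cn _; rewrite normalize_scale // lt_neqAle eq_sym cn.
Qed.

Let chord_early i (y : sphere R (k i)) t : -1 < dot (\val (b i)) (\val y) ->
  0 <= t <= 1 -> t <= 1 / 2 -> normalize (chord (b i) y t) = b i.
Proof.
move=> xy t01 t2; apply: (chord_b (c := wx y t + wb (b i) y t)) => //.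
  by rewrite /chord wy_early // scale0r addr0 scalerDl.
by rewrite addr_ge0 ?wb_ge0.
Qed.

Let chord_late i (x : sphere R (k i)) t : -1 < dot (\val x) (\val (b i)) ->
  0 <= t <= 1 -> 1 / 2 <= t -> normalize (chord x (b i) t) = b i.
Proof.
move=> xy t01 t2; apply: (chord_b (c := wy x t + wb x (b i) t)) => //.
  by rewrite /chord wx_late // scale0r add0r scalerDl.
by rewrite addr_ge0 ?wb_ge0.
Qed.

Section PathContinuity.
Variables (T : topologicalType) (i : 'I_n) (x y : T -> sphere R (k i)) (t : T -> R) (z : T).
Hypotheses (cx : cont_at x z) (cy : cont_at y z) (ct : cont_at t z).

Let rho_cont (f : T -> sphere R (k i)) : cont_at f z -> cont_at (fun u => rho (f u)) z.
Proof.
move=> cf; apply: cont_at_mul; last exact: cont_at_cst.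
apply: cont_at_add; first exact: cont_at_cst.
by apply: cont_at_opp; apply: cont_at_dot; [exact: cont_at_val|exact: cont_at_cst].
Qed.

Let wx_cont : cont_at (fun u => wx (y u) (t u)) z.
Proof.
apply: cont_at_max; first exact: cont_at_cst.
apply: cont_at_add; last exact: cont_at_opp.
by apply: cont_at_add; [exact: cont_at_cst|exact: rho_cont].
Qed.

Let wy_cont : cont_at (fun u => wy (x u) (t u)) z.
Proof.
apply: cont_at_max; first exact: cont_at_cst.
apply: cont_at_add; last exact: rho_cont.
by apply: cont_at_add; [|exact: cont_at_cst].
Qed.

Let wb_cont : cont_at (fun u => wb (x u) (y u) (t u)) z.
Proof.
apply: cont_at_mul.
  apply: cont_at_max; first exact: cont_at_cst.
  apply: cont_at_add; last by apply: cont_at_opp; exact: rho_cont.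
  by apply: cont_at_add; [exact: cont_at_cst|apply: cont_at_opp; exact: rho_cont].
apply: cont_at_mul => //; apply: cont_at_add; first exact: cont_at_cst.
exact: cont_at_opp.
Qed.

Let cont_at_chord : cont_at (fun u => chord (x u) (y u) (t u)) z.
Proof.
apply: cont_at_addv; first apply: cont_at_addv; apply: cont_at_scale => //;
  try exact: cont_at_val; exact: cont_at_cst.
Qed.

Let cont_at_turn : 0 < wx (y z) (t z) + wy (x z) (t z) ->
  cont_at (fun u => turn (x u) (y u) (t u)) z.
Proof.
move=> p; apply: cont_at_half_turn; try exact: cont_at_val.
  by apply: cont_at_tangent; exact: cont_at_val.
apply: cont_at_mul => //; apply: cont_at_inv; first by rewrite gt_eqF.
exact: cont_at_add.
Qed.

Lemma cont_at_normalize_chord : -1 < dot (\val (x z)) (\val (y z)) ->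
  0 <= t z <= 1 -> cont_at (fun u => normalize (chord (x u) (y u) (t u))) z.
Proof. by move=> xy t01; apply: cont_at_normalize => //; exact: chord_path_neq0. Qed.

Lemma cont_at_normalize_turn : dot (\val (x z)) (\val (y z)) < 1 ->
  cont_at (fun u => normalize (turn (x u) (y u) (t u))) z.
Proof.
move=> xy; apply: cont_at_normalize.
  by apply: tangent_half_turn => //; exact: turn_frac.
by apply: cont_at_turn; apply: lt_le_trans (neq_rho xy) _; exact: wxy_ge.
Qed.
End PathContinuity.

Lemma TC_cover_rank : (0 < s)%N -> TC_cover R s X ((s - 1) * n).
Proof.
move=> s0; pose l0 : 'I_s := Ordinal s0.
pose w (a : 'I_s * 'I_n) (z : Z) : R :=
  2 - 2 * dot (\val (pt z l0 a.2)) (\val (pt z a.1 a.2)).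
have wE a z : w a z = 2 - 2 * dot (\val (pt z l0 a.2)) (\val (pt z a.1 a.2)) by [].
apply: (@TC_cover_of_strata R s X _ w) => [||A z [_ [W2 _]]|A].
- exact: skeleton_inhabited.
- move=> a; apply: cont_atP => z; apply: cont_at_add; first exact: cont_at_cst.
  apply: cont_at_opp; apply: cont_at_mul; first exact: cont_at_cst.
  by apply: cont_at_dot; apply: cont_at_val; apply: pt_cont; exact: cont_at_id.
(* In row [l0] each point is compared with itself, so [w = 0] and [A] has no pair there; the other
   [s - 1] rows give at most [n] pairs each. *)
- rewrite card_pairs (bigD1 l0) //= eq_card0 => [|i]; last first.
    by rewrite !inE; apply/negP => /W2; rewrite wE sphere_unit; lra.
  rewrite add0n -[s in (s - 1)%N](card_ord s) subn1 -(cardC1 l0).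
  rewrite -(sum_nat_const (predC1 l0) n).
  apply: leq_sum => l _; rewrite -[X in (_ <= X)%N](card_ord n).
  exact: max_card.
set W := (X in has_section_over R X).
pose tm (x : (W * unit_interval R)%type) : R := \val x.2.
pose g (l : 'I_s) i (x : (W * unit_interval R)%type) : sphere R (k i) :=
  if (l, i) \in A
  then normalize (turn (pt (\val x.1) l0 i) (pt (\val x.1) l i) (tm x))
  else normalize (chord (pt (\val x.1) l0 i) (pt (\val x.1) l i) (tm x)).
have tm_cont x : cont_at tm x by apply: cont_at_val; exact: cvg_snd.
have tm01 x : 0 <= tm x <= 1 by have := set_valP x.2; rewrite /= in_itv.
have ptx_cont l i x : cont_at (fun x : (W * unit_interval R)%type => pt (\val x.1) l i) x.
  by apply: pt_cont; apply: cont_at_val; exact: cvg_fst.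
have dotA (x : W) l i : (l, i) \in A ->
    dot (\val (pt (\val x) l0 i)) (\val (pt (\val x) l i)) < 1.
  by move=> liA; have [_ [/(_ _ liA) + _]] := set_valP x; rewrite wE /=; lra.
have dotB (x : W) l i : (l, i) \notin A ->
    -1 < dot (\val (pt (\val x) l0 i)) (\val (pt (\val x) l i)).
  by move=> liA; have [_ [_ /(_ _ liA)]] := set_valP x; rewrite wE /=; lra.
apply: (@skeleton_section W g).
- move=> l i; apply: cont_atP => x; rewrite /g; have [liA|liA] := boolP ((l, i) \in A).
    by apply: cont_at_normalize_turn => //; exact: dotA.
  by apply: cont_at_normalize_chord => //; exact: dotB.
- suff g0 l i v : g l i (v, I0 R) = pt (\val v) l0 i by move=> l i l' v; rewrite !g0.
  rewrite /g /tm /=; case: ifP => _.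
    by rewrite /turn wy0 mul0r half_turn0 -[\val _]scale1r normalize_scale.
  by rewrite /chord wy0 wb0 !scale0r !addr0 normalize_scale.
- move=> l i v; rewrite /g /tm /=; case: ifP => _.
    rewrite /turn wx1 add0r divff ?half_turn1; last by rewrite gt_eqF.
    by rewrite -[\val _]scale1r normalize_scale.
  by rewrite /chord wx1 wb1 !scale0r addr0 add0r normalize_scale.
(* Up to time 1/2 the nonbase coordinates are among those of the first point, and from then on among
   those of the [l]-th point, so there are never more than [d]. *)
move=> l x; have [t2|/ltW t2] := leP (tm x) (1 / 2).
  apply: leq_trans (pt_skel (\val x.1) l0).
  apply/subset_leq_card/fintype.subsetP => i; rewrite !inE; apply: contra => /eqP xb.
  rewrite /g xb; have [liA|liA] := boolP ((l, i) \in A).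
    by rewrite turn_early // -[\val _]scale1r normalize_scale.
  by rewrite chord_early //; have := dotB x.1 _ _ liA; rewrite xb.
apply: leq_trans (pt_skel (\val x.1) l).
apply/subset_leq_card/fintype.subsetP => i; rewrite !inE; apply: contra => /eqP yb.
rewrite /g yb; have [liA|liA] := boolP ((l, i) \in A).
  rewrite turn_late //; first by rewrite -[\val _]scale1r normalize_scale.
  by have := dotA x.1 _ _ liA; rewrite yb.
by rewrite chord_late //; have := dotB x.1 _ _ liA; rewrite yb.
Qed.

End UpperBounds.

Local Close Scope ring_scope.
Local Close Scope classical_set_scope.

Theorem corollary2p11 (R : realType) (s n d : nat) (k : 'I_n -> nat)
    (b : forall i : 'I_n, sphere R (k i)) :
  (2 <= s)%N -> (forall i : 'I_n, odd (k i)) -> (1 <= d <= n)%N ->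
  is_TC R s (skeleton b d) (minn (s * d) ((s - 1) * n)).
Proof.
move=> s2 kodd dn; split; last first.
  by move=> m'; apply: TC_cover_lower => // i; exact: odd_gt0.
have [_|_] := leqP; first by apply: TC_cover_dim => //; case/andP: dn.
by apply: TC_cover_rank => //; exact: ltnW.
Qed.
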